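(* Let $P\subset\mathbb R^n$ be an $n$-dimensional convex polytope. Then $P$ is strongly monotypic if and only if no $n+1$ elements of $N(P)$ are in conical position.
   Context: $N(P)$ is the finite set of outward unit normal vectors of the facets of $P$. $P$ is strongly monotypic if every polytope $Q$ with $N(Q)=N(P)$ has the property that the arrangement of the hyperplanes spanned by the facets of $Q$ is combinatorially equivalent to the arrangement of the hyperplanes spanned by the facets of $P$. A set of points is separated from $0$ if some hyperplane strictly separates the set from the origin. A finite set of points is in conical position if it is separated from $0$ and none of its points lies in the positive hull (set of nonnegative linear combinations) of the others. *)

(* Defs.v *)
From HB Require Import structures.
From mathcomp Require Import all_boot all_order all_algebra.
From mathcomp Require Import all_classical all_reals topology normedtype.

Set Implicit Arguments.
Unset Strict Implicit.
Unset Printing Implicit Defensive.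

Import Order.TTheory GRing.Theory Num.Theory.
Import numFieldNormedType.Exports.

Local Open Scope classical_set_scope.
Local Open Scope ring_scope.

Section Polytopes.
Context {R : realType} {n : nat}.
Local Notation V := 'rV[R]_n.

(* The norm that the library puts on row vectors is the maximum norm, hence the
   Euclidean product and norm are introduced here. *)
Definition dot (u v : V) : R := \sum_(i < n) u 0 i * v 0 i.
Definition enorm (u : V) : R := Num.sqrt (dot u u).

Definition conv_hull (S : set V) : set V :=
  [set x | exists (m : nat) (v : 'I_m -> V) (c : 'I_m -> R),
    [/\ forall i, S (v i), forall i, 0 <= c i, \sum_i c i = 1
      & x = \sum_i c i *: v i]].

Definition aff_hull (S : set V) : set V :=
  [set x | exists (m : nat) (v : 'I_m -> V) (c : 'I_m -> R),
    [/\ forall i, S (v i), \sum_i c i = 1 & x = \sum_i c i *: v i]].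

Definition pos_hull (S : set V) : set V :=
  [set x | exists (m : nat) (v : 'I_m -> V) (c : 'I_m -> R),
    [/\ forall i, S (v i), forall i, 0 <= c i & x = \sum_i c i *: v i]].

(* Dimension of the affine hull; no [d] satisfies [has_dim set0 d]. *)
Definition has_dim (S : set V) (d : nat) : Prop :=
  exists (x : V) (U : {vspace V}),
    \dim U = d /\ aff_hull S = [set x + u | u in [set` U]].

Definition polytope (P : set V) : Prop :=
  exists A : set V, finite_set A /\ P = conv_hull A.

Definition support_face (P : set V) (u : V) : set V :=
  [set x | P x /\ forall y, P y -> dot u y <= dot u x].

(* Facets of a full-dimensional polytope: proper faces of dimension n - 1. *)
Definition facet (P F : set V) : Prop :=
  (exists2 u : V, u != 0 & F = support_face P u) /\
  (exists2 d : nat, d.+1 = n & has_dim F d).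

Definition outward_unit_normal (P F : set V) (u : V) : Prop :=
  enorm u = 1 /\
  exists c : R, (forall x, P x -> dot u x <= c) /\ (forall x, F x -> dot u x = c).

Definition normals (P : set V) : set V :=
  [set u | exists2 F, facet P F & outward_unit_normal P F u].

Definition facet_arrangement (P : set V) : set (set V) :=
  [set aff_hull F | F in facet P].

(* Two points have the same position with respect to a hyperplane H if both lie
   on H or both lie in the same open half-space, that is, the segment joining
   them misses H. *)
Definition same_position (H : set V) (x y : V) : Prop :=
  (H x /\ H y) \/ conv_hull [set x; y] `&` H = set0.

Definition open_cell (A : set (set V)) (x : V) : set V :=
  [set y | forall H, A H -> same_position H x y].

(* The closed cells, of all dimensions, into which A decomposes the space. *)
Definition cells (A : set (set V)) : set (set V) :=
  [set closure (open_cell A x) | x in [set: V]].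

(* Isomorphism of the cell complexes, as posets under inclusion. *)
Definition combinatorially_equivalent (A B : set (set V)) : Prop :=
  exists f : set V -> set V,
    set_bij (cells A) (cells B) f /\
    forall C D, cells A C -> cells A D -> (f C `<=` f D <-> C `<=` D).

(* Outward normals of facets only make sense for full-dimensional polytopes,
   so Q ranges over those. *)
Definition strongly_monotypic (P : set V) : Prop :=
  forall Q : set V, polytope Q -> has_dim Q n -> normals Q = normals P ->
    combinatorially_equivalent (facet_arrangement Q) (facet_arrangement P).

(* The hyperplane is {x | dot a x = b}; up to replacing (a, b) by (-a, -b) the
   origin is on its negative side. *)
Definition separated_from_0 (S : set V) : Prop :=
  exists (a : V) (b : R),
    [/\ a != 0, dot a 0 < b & forall x, S x -> b < dot a x].

Definition conical_position (S : set V) : Prop :=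
  [/\ finite_set S, separated_from_0 S
    & forall x, S x -> ~ pos_hull (S `\ x) x].

End Polytopes.

(* Main.v *)
Require Import Defs.
From HB Require Import structures.
From mathcomp Require Import all_boot all_order all_algebra.
From mathcomp Require Import all_classical all_reals topology normedtype.
From mathcomp Require Import ring lra.

Set Implicit Arguments.
Unset Strict Implicit.
Unset Printing Implicit Defensive.

Import Order.TTheory GRing.Theory Num.Theory.
Import numFieldNormedType.Exports.

Local Open Scope classical_set_scope.
Local Open Scope card_scope.
Local Open Scope ring_scope.

(** Write [h u] for the offset of the facet of [Q] with normal [u].  Its
    hyperplanes can only be concurrent in conical position: if the hyperplanes of
    [S] meet in [x] and [z] is interior to [Q], then [x - z] separates [S] from 0,
    and a relative interior point [y] of the facet with normal [u] shows, through
    [y - x], that [u] is not in the positive hull of the rest of [S].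

    Hence, if no [n + 1] normals are in conical position, every arrangement with
    these normals is simple.  The admissible offsets [h] form a convex set, so the
    side of [u] on which the vertex cut out by a basis [B] of normals lies does not
    depend on [h].  A sign vector is feasible iff it lies above the sign vector of
    some vertex, so all these arrangements have the same sign vectors.

    Conversely, for [n + 1] normals [S] in conical position Farkas' lemma gives
    centers of unit balls such that the polytope circumscribed about the balls,
    with all normals of [P], has the hyperplanes of [S] passing through 0.  Its
    arrangement then has fewer vertices than there are bases of normals, whereas a
    generic choice of offsets gives exactly one vertex per basis. *)

(** * The Euclidean inner product and norm *)

Section Dot.
Context {R : realType} {n : nat}.
Local Notation V := 'rV[R]_n.
Implicit Types u v w : V.

Lemma dotC u v : dot u v = dot v u.
Proof. by apply: eq_bigr => i _; rewrite mulrC. Qed.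

Lemma dotDr u v w : dot u (v + w) = dot u v + dot u w.
Proof. by rewrite -big_split; apply: eq_bigr => i _; rewrite mxE mulrDr. Qed.

Lemma dotZr a u v : dot u (a *: v) = a * dot u v.
Proof. by rewrite mulr_sumr; apply: eq_bigr => i _; rewrite mxE mulrCA. Qed.

Lemma dotNr u v : dot u (- v) = - dot u v.
Proof. by rewrite -scaleN1r dotZr mulN1r. Qed.

Lemma dotBr u v w : dot u (v - w) = dot u v - dot u w.
Proof. by rewrite dotDr dotNr. Qed.

Lemma dot0r u : dot u 0 = 0.
Proof. by rewrite -(scale0r 0) dotZr mul0r. Qed.

Lemma dotZl a u v : dot (a *: v) u = a * dot v u.
Proof. by rewrite !(dotC _ u) dotZr. Qed.

Lemma dotNl u v : dot (- v) u = - dot v u.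
Proof. by rewrite !(dotC _ u) dotNr. Qed.

Lemma dotBl u v w : dot (v - w) u = dot v u - dot w u.
Proof. by rewrite !(dotC _ u) dotBr. Qed.

Lemma dot0l u : dot 0 u = 0.
Proof. by rewrite dotC dot0r. Qed.

Lemma dot_sumr (I : Type) (r : seq I) (P : pred I) (f : I -> V) u :
  dot u (\sum_(i <- r | P i) f i) = \sum_(i <- r | P i) dot u (f i).
Proof. by apply: (big_morph (dot u)) => [v w|]; rewrite ?dotDr ?dot0r. Qed.

Lemma dot_suml (I : Type) (r : seq I) (P : pred I) (f : I -> V) u :
  dot (\sum_(i <- r | P i) f i) u = \sum_(i <- r | P i) dot (f i) u.
Proof. by rewrite dotC dot_sumr; apply: eq_bigr => i _; rewrite dotC. Qed.

Lemma dot_ge0 u : 0 <= dot u u.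
Proof. by apply: sumr_ge0 => i _; rewrite -expr2 sqr_ge0. Qed.

Lemma dot_eq0 u : (dot u u == 0) = (u == 0).
Proof.
apply/idP/eqP => [|->]; last by rewrite dot0r.
rewrite psumr_eq0 => [/allP h|i _]; last by rewrite -expr2 sqr_ge0.
apply/rowP => i; rewrite mxE.
by have := h i (mem_index_enum _); rewrite -expr2 sqrf_eq0 => /eqP.
Qed.

Lemma dot_gt0 u : (0 < dot u u) = (u != 0).
Proof. by rewrite lt_def dot_ge0 andbT dot_eq0. Qed.

Lemma dot_ext u v : (forall w, dot u w = dot v w) -> u = v.
Proof.
move=> h; apply/eqP; rewrite -subr_eq0 -dot_eq0 dotBl.
by rewrite (h (u - v)) subrr.
Qed.

Lemma enorm1 u : enorm u = 1 -> dot u u = 1.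
Proof. by move=> h; rewrite -[LHS]sqr_sqrtr ?dot_ge0// -/(enorm u) h expr1n. Qed.

Lemma enorm_gt0 u : u != 0 -> 0 < enorm u.
Proof. by rewrite -dot_gt0 sqrtr_gt0. Qed.

Lemma enorm_normalize u : u != 0 -> enorm ((enorm u)^-1 *: u) = 1.
Proof.
move=> /enorm_gt0 h; rewrite /enorm dotZl dotZr mulrA.
rewrite -[X in _ * X](@sqr_sqrtr _ (dot u u)) ?dot_ge0// -/(enorm u).
by rewrite -expr2 -exprMn mulVf ?gt_eqF// expr1n sqrtr1.
Qed.

Lemma unit_neq0 u : dot u u = 1 -> u != 0.
Proof. by rewrite -dot_gt0 => ->. Qed.

Lemma dot_unit_lt1 u v : dot u u = 1 -> dot v v = 1 -> u != v -> dot u v < 1.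
Proof.
move=> hu hv; rewrite -subr_eq0 -dot_gt0 dotBl !dotBr hu hv (dotC v u).
by move=> h; lra.
Qed.

End Dot.

(** * Convex and affine hulls *)

Section Hulls.
Context {R : realType} {n : nat}.
Local Notation V := 'rV[R]_n.
Implicit Types (S T : set V) (x y u : V).

(** The hulls are defined with ordinal indices; reindexing by [enum_val] admits sums over any subset
    of a finite type. *)
Lemma conv_hull_sum (I : finType) (A : {pred I}) S (v : I -> V) (c : I -> R) :
  (forall i, i \in A -> S (v i)) -> (forall i, i \in A -> 0 <= c i) ->
  \sum_(i in A) c i = 1 -> conv_hull S (\sum_(i in A) c i *: v i).
Proof.
move=> hv hc h1.
exists #|A|, (fun k => v (enum_val k)), (fun k => c (enum_val k)); split.
- by move=> i; apply/hv/enum_valP.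
- by move=> i; apply/hc/enum_valP.
- by rewrite -big_enum_val.
- by rewrite big_enum_val.
Qed.

Lemma aff_hull_sum (I : finType) (A : {pred I}) S (v : I -> V) (c : I -> R) :
  (forall i, i \in A -> S (v i)) ->
  \sum_(i in A) c i = 1 -> aff_hull S (\sum_(i in A) c i *: v i).
Proof.
move=> hv h1.
exists #|A|, (fun k => v (enum_val k)), (fun k => c (enum_val k)); split.
- by move=> i; apply/hv/enum_valP.
- by rewrite -big_enum_val.
- by rewrite big_enum_val.
Qed.

Lemma sub_conv_hull S : S `<=` conv_hull S.
Proof.
move=> x Sx; exists 1%N, (fun=> x), (fun=> 1); split => //.
  by rewrite big_ord1.
by rewrite big_ord1 scale1r.
Qed.

(** Since [t] is arbitrary, stretching a short segment with endpoints in [S] stays in the affine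
    hull; this is how hulls are shown to be large. *)
Lemma aff_hull_line S x y (t : R) : S x -> S y -> aff_hull S (x + t *: (y - x)).
Proof.
move=> Sx Sy.
have -> : x + t *: (y - x) =
    \sum_(b in [pred b : bool | true]) (if b then t else 1 - t) *: (if b then y else x).
  by rewrite big_bool; apply/rowP => k; rewrite !mxE; lra.
apply: aff_hull_sum => [[]//|].
by rewrite big_bool /=; lra.
Qed.

Definition convex S := forall x y (t : R), S x -> S y -> 0 <= t <= 1 ->
  S (x + t *: (y - x)).

Lemma conv_hull_convex S : convex (conv_hull S).
Proof.
move=> x y t [m [v [c [hv hc c1 ->]]]] [m' [v' [c' [hv' hc' c'1 ->]]]] /andP[t0 t1].
set z := (X in conv_hull S X).
(* The two combinations are joined over the disjoint sum of their index types, weighted by [1 - t]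
   and [t]. *)
have -> : z = \sum_(i in predT)
    (match i with inl i => (1 - t) * c i | inr j => t * c' j end : R) *:
    (match i with inl i => v i | inr j => v' j end : V).
  rewrite big_sumType /=.
  under eq_bigr do rewrite -scalerA.
  under [X in _ = _ + X]eq_bigr do rewrite -scalerA.
  by rewrite -!scaler_sumr /z; apply/rowP => k; rewrite !mxE; ring.
apply: conv_hull_sum => [[]//|[] i _|].
- by rewrite mulr_ge0// subr_ge0.
- by rewrite mulr_ge0.
- by rewrite big_sumType /= -!mulr_sumr c1 c'1 !mulr1 subrK.
Qed.

Lemma conv_hull_le S u (a : R) x :
  (forall y, S y -> dot u y <= a) -> conv_hull S x -> dot u x <= a.
Proof.
move=> h [m [v [c [hv hc c1 ->]]]].
rewrite dot_sumr -[a]mul1r -c1 mulr_suml; apply: ler_sum => i _.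
by rewrite dotZr ler_wpM2l ?h.
Qed.

Lemma aff_hull_eq S u (a : R) x :
  (forall y, S y -> dot u y = a) -> aff_hull S x -> dot u x = a.
Proof.
move=> h [m [v [c [hv c1 ->]]]].
rewrite dot_sumr -[RHS]mul1r -c1 mulr_suml; apply: eq_bigr => i _.
by rewrite dotZr h.
Qed.

Lemma support_face_convex S u : convex S -> convex (support_face S u).
Proof.
move=> cS x y t [Sx mx] [Sy my] t01; split; first exact: cS.
move=> z Sz; rewrite dotDr dotZr dotBr.
have -> : dot u y = dot u x by apply/le_anti; rewrite mx// my.
by rewrite subrr mulr0 addr0 mx.
Qed.

(* Averaging the witnesses makes all inequalities strict at once. *)
Lemma convex_strict_point S (I : eqType) (r : seq I) (w : I -> V) (h : I -> R) :
  convex S -> S !=set0 -> (forall i x, i \in r -> S x -> dot (w i) x <= h i) ->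
  (forall i, i \in r -> exists2 x, S x & dot (w i) x < h i) ->
  exists2 x, S x & forall i, i \in r -> dot (w i) x < h i.
Proof.
move=> cS [x0 Sx0]; elim: r => [|i r IH] hle hlt; first by exists x0.
have [|j jr|x Sx hx] := IH.
- by move=> j x jr; apply: hle; rewrite inE jr orbT.
- by apply: hlt; rewrite inE jr orbT.
have [y Sy hy] := hlt i (mem_head _ _).
exists (x + 2^-1 *: (y - x)); first by apply: cS => //; lra.
move=> j; rewrite dotDr dotZr dotBr inE => /orP[/eqP->|jr].
  by have := hle i x (mem_head _ _) Sx; lra.
have := hx j jr; have := hle j y; rewrite inE jr orbT => /(_ isT Sy).
by lra.
Qed.

End Hulls.

(** * Spanning families, dual bases and the vertices they cut out *)

Section Span.
Context {R : realType} {n : nat} {I : finType}.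
Local Notation V := 'rV[R]_n.
Variable w : I -> V.
Implicit Types (B T : {set I}) (h : I -> R).

(** Stated through the orthogonal complement, since it serves to show that a point is determined by
    the hyperplanes through it. *)
Definition spanning T := forall v, (forall i, i \in T -> dot (w i) v = 0) -> v = 0.

Definition is_basis B := minset (fun T => `[< spanning T >]) B.

Lemma basis_exists T : spanning T -> exists2 B : {set I}, B \subset T & is_basis B.
Proof.
move=> /asboolP sT.
by have [B hB BT] := minset_exists (P := fun T => `[< spanning T >]) sT; exists B.
Qed.

Lemma basis_spanning B : is_basis B -> spanning B.
Proof. by move=> /minsetp/asboolP. Qed.

(** The dual basis. For a basis [B], [dualP] shows that such a family exists, so that [xget] does
    not fall back on [0]. *)
Definition dual B : I -> V :=
  xget (fun=> 0) [set d | forall i j, i \in B -> j \in B -> dot (w i) (d j) = (i == j)%:R].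

Lemma dualP B i j : is_basis B -> i \in B -> j \in B ->
  dot (w i) (dual B j) = (i == j)%:R.
Proof.
move=> hB.
suff [d hd] : [set d : I -> V | forall i j, i \in B -> j \in B ->
    dot (w i) (d j) = (i == j)%:R] !=set0.
  by move: i j; exact: (@xgetPex _ (fun=> 0) _ (ex_intro _ d hd)).
have : forall j, exists d, j \in B -> forall i, i \in B -> dot (w i) d = (i == j)%:R.
  move=> {i} {}j; have [jB|_] := boolP (j \in B); last by exists 0.
  (* Minimality of [B] yields a nonzero [v] orthogonal to all of [B] except [w j]; rescaling it
     gives the dual vector. *)
  have : ~ spanning (B :\ j)%SET.
    move=> /asboolP s; have [_ /(_ _ s (subsetDl _ _)) e] := minsetP hB.
    by move: jB; rewrite -e finset.in_setD1 eqxx.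
  move=> /existsNP[v /not_implyP[hv v0]].
  have hj : dot (w j) v != 0.
    apply/negP => /eqP e; apply: v0; apply: (basis_spanning hB) => i iB.
    by have [->//|ij] := eqVneq i j; apply: hv; rewrite finset.in_setD1 ij.
  exists ((dot (w j) v)^-1 *: v) => _ i iB; rewrite dotZr.
  have [->|ij] := eqVneq i j; first by rewrite mulVf.
  have -> : dot (w i) v = 0 by apply: hv; rewrite finset.in_setD1 ij.
  by rewrite mulr0.
by move=> /choice[d hd]; exists d => k l kB lB; exact: hd.
Qed.

Lemma basis_expand B v : is_basis B -> v = \sum_(b in B) dot (w b) v *: dual B b.
Proof.
move=> hB; apply/eqP; rewrite -subr_eq0; apply/eqP.
apply: (basis_spanning hB) => i iB; rewrite dotBr dot_sumr (bigD1 i)//=.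
rewrite dotZr dualP// eqxx mulr1 big1 ?addr0 ?subrr// => j /andP[jB ji].
by rewrite dotZr dualP// eq_sym (negPf ji) mulr0.
Qed.

Lemma basis_expand_dual B v : is_basis B -> v = \sum_(b in B) dot (dual B b) v *: w b.
Proof.
move=> hB; apply: dot_ext => z.
rewrite {1}(basis_expand z hB) dot_sumr dot_suml; apply: eq_bigr => b _.
by rewrite dotZr dotZl mulrC (dotC v).
Qed.

(** The matrix of the basis and the transposed matrix of its dual basis are inverse on both sides,
    which bounds [#|B|] by [n] and [n] by [#|B|]. *)
Lemma card_basis B : is_basis B -> #|B| = n.
Proof.
move=> hB.
pose W := \matrix_(k < #|B|) w (enum_val k).
pose D := \matrix_(k < #|B|) dual B (enum_val k).
have WD : W *m D^T = 1%:M.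
  apply/matrixP => i j; rewrite !mxE.
  rewrite (eq_bigr (fun k => w (enum_val i) 0 k * dual B (enum_val j) 0 k)); last first.
    by move=> k _; rewrite !mxE.
  rewrite -[LHS]/(dot _ _) dualP ?enum_valP//.
  by rewrite (inj_eq enum_val_inj).
have DW : D^T *m W = 1%:M.
  apply/row_matrixP => i; rewrite row_mul row1.
  have -> : row i D^T *m W =
      \sum_(k < #|B|) dot (dual B (enum_val k)) (delta_mx 0 i) *: w (enum_val k).
    rewrite mulmx_sum_row; apply: eq_bigr => k _; rewrite rowK; congr (_ *: _).
    rewrite !mxE /dot (bigD1 i)//= mxE !eqxx mulr1 big1 ?addr0// => j ji.
    by rewrite mxE (negPf ji) mulr0.
  by rewrite -(big_enum_val (fun b => dot (dual B b) (delta_mx 0 i) *: w b)) -basis_expand_dual.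
by apply/eqP; rewrite eqn_leq (mulmx1_min WD) (mulmx1_min DW).
Qed.

(** For a basis [B], the point where its hyperplanes with offsets [h] meet, in dual coordinates; it
    is linear in [h]. *)
Definition vertex B h : V := \sum_(b in B) h b *: dual B b.

Lemma vertexP B h i : is_basis B -> i \in B -> dot (w i) (vertex B h) = h i.
Proof.
move=> hB iB; rewrite dot_sumr (bigD1 i)//= dotZr dualP// eqxx mulr1.
rewrite big1 ?addr0// => j /andP[jB ji].
by rewrite dotZr dualP// eq_sym (negPf ji) mulr0.
Qed.

Lemma vertex_unique B h x : is_basis B -> (forall i, i \in B -> dot (w i) x = h i) ->
  x = vertex B h.
Proof.
move=> hB hx; rewrite (basis_expand x hB).
by apply: eq_bigr => b bB; rewrite hx.
Qed.

Lemma vertex_affine B h g (t : R) :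
  vertex B (fun i => h i + t * g i) = vertex B h + t *: vertex B g.
Proof.
rewrite scaler_sumr -big_split; apply: eq_bigr => b _.
by rewrite /= scalerDl scalerA.
Qed.

(** Slack of the inequality of [i] at the vertex of [B]: it vanishes exactly when the hyperplane of
    [i] passes through that vertex, and it is linear in [h]. *)
Definition gap B h i := h i - dot (w i) (vertex B h).

Lemma gap_affine B h g (t : R) i :
  gap B (fun i => h i + t * g i) i = gap B h i + t * gap B g i.
Proof. by rewrite /gap vertex_affine dotDr dotZr; lra. Qed.

End Span.

(** * Statements that hold for all sufficiently small positive parameters *)

Section Small.
Context {R : realType}.

Definition small (p : R -> Prop) := exists2 e : R, 0 < e & forall t, 0 < t < e -> p t.

Lemma small_ex p : small p -> exists2 t, 0 < t & p t.
Proof. by move=> [e e0 h]; exists (e / 2); [|apply: h]; lra. Qed.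

Lemma small_and p q : small p -> small q -> small (fun t => p t /\ q t).
Proof.
move=> [e e0 hp] [d d0 hq]; exists (Num.min e d); first by rewrite lt_min e0.
by move=> t /andP[t0]; rewrite lt_min => /andP[te td]; split; [apply: hp|apply: hq]; rewrite t0.
Qed.

Lemma small_forall (I : finType) (p : I -> R -> Prop) :
  (forall i, small (p i)) -> small (fun t => forall i, p i t).
Proof.
move=> h.
suff [e e0 he] : small (fun t => forall i, i \in enum I -> p i t).
  by exists e => // t te i; apply: he => //; rewrite mem_enum.
elim: (enum I) => [|i s IH]; first by exists 1.
have [e e0 he] := small_and (h i) IH.
exists e => // t /he[pi ps] j; rewrite inE => /orP[/eqP->//|]; exact: ps.
Qed.

Lemma small_lt (a b c d : R) : a < b -> small (fun t => a + t * c < b + t * d).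
Proof.
(* Adding 1 keeps the bound on the slope positive even if [c = d]. *)
move=> ab; have m0 : 0 < `|c - d| + 1 by rewrite ltr_wpDl.
exists ((b - a) / (`|c - d| + 1)); first by rewrite divr_gt0// subr_gt0.
move=> t /andP[t0]; rewrite ltr_pdivlMr// => h.
have h1 : t * (c - d) <= t * `|c - d| by rewrite ler_pM2l// ler_norm.
by move: h h1; rewrite mulrDr mulrBr; lra.
Qed.

Lemma small_neq0 (a b : R) : a != 0 -> small (fun t => a + t * b != 0).
Proof.
rewrite neq_lt => /orP[a0|a0].
  have [e e0 he] := small_lt b 0 a0; exists e => // t /he.
  by rewrite mulr0 addr0 => /lt_eqF->.
have [e e0 he] := small_lt 0 b a0; exists e => // t /he.
by rewrite mulr0 addr0 => /gt_eqF->.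
Qed.

Lemma small_sg (a b : R) : a != 0 -> small (fun t => Num.sg (a + t * b) = Num.sg a).
Proof.
rewrite neq_lt => /orP[a0|a0].
  have [e e0 he] := small_lt b 0 a0; exists e => // t /he.
  by rewrite mulr0 addr0 => h; rewrite !ltr0_sg.
have [e e0 he] := small_lt 0 b a0; exists e => // t /he.
by rewrite mulr0 addr0 => h; rewrite !gtr0_sg.
Qed.

Lemma argmin_exists (I : finType) (P : pred I) (F : I -> R) i0 : P i0 ->
  exists2 i, P i & forall j, P j -> F i <= F j.
Proof. by move=> /(arg_minP F)[i Pi hi]; exists i. Qed.

End Small.

(** * Sign vectors of an arrangement, and polyhedra with given normals *)

Section Arrangement.
Context {R : realType} {n : nat} {I : finType}.
Local Notation V := 'rV[R]_n.
Variable w : I -> V.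
Implicit Types (h : I -> R) (x y v : V).

Definition hyperplane (u : V) (c : R) : set V := [set x | dot u x = c].

Definition sgn h x i : R := Num.sg (dot (w i) x - h i).

Definition tight h x : {set I} := [set i | dot (w i) x == h i]%SET.

(* The face order on sign vectors. *)
Definition below (s t : I -> R) := forall i, s i = 0 \/ s i = t i.

Lemma in_tight h x i : (i \in tight h x) = (dot (w i) x == h i).
Proof. by rewrite finset.in_set. Qed.

Lemma sgn_eq0 h x i : (sgn h x i == 0) = (i \in tight h x).
Proof. by rewrite /sgn sgr_eq0 subr_eq0 in_tight. Qed.

Lemma belowxx s : below s s. Proof. by move=> i; right. Qed.

Lemma below_trans t s r : below s t -> below t r -> below s r.
Proof.
move=> st tr i; case: (st i) => [->|->]; first by left.
exact: tr.
Qed.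

Lemma below_anti s t : below s t -> below t s -> s = t.
Proof.
by move=> st ts; apply/funext => i; case: (st i) => // e; case: (ts i) => // ->.
Qed.

Lemma below_tight h y x : below (sgn h y) (sgn h x) -> tight h x \subset tight h y.
Proof.
move=> b; apply/fintype.subsetP => i; rewrite -!sgn_eq0 => /eqP e.
by case: (b i) => ->; rewrite ?e eqxx.
Qed.

Lemma tight_spanning_inj h x y : spanning w (tight h x) ->
  tight h x \subset tight h y -> x = y.
Proof.
move=> sp /fintype.subsetP xy; apply/eqP; rewrite -subr_eq0; apply/eqP/sp => i ix.
rewrite dotBr; move: (ix) (xy _ ix); rewrite !in_tight => /eqP-> /eqP->.
by rewrite subrr.
Qed.

Lemma not_spanning T : ~ spanning w T ->
  exists2 v, v != 0 & forall i, i \in T -> dot (w i) v = 0.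
Proof. by move=> /existsNP[v /not_implyP[hv /eqP v0]]; exists v. Qed.

(** While the tight normals do not span, move along a direction orthogonal to them up to the first
    new hyperplane: signs only change to 0, and the tight set grows. *)
Lemma vertex_below h x : spanning w [set: I]%SET ->
  exists2 y, below (sgn h y) (sgn h x) & spanning w (tight h y).
Proof.
move=> spT.
have [k] := ubnP #|~: tight h x|; elim: k x => // k IH x; rewrite ltnS => kx.
have [sp|/not_spanning[v v0 hv]] := pselect (spanning w (tight h x)).
  by exists x => //; exact: belowxx.
have [i0 hi0] : exists i, dot (w i) v != 0.
  apply: contrapT => /forallNP no; move/eqP: v0; apply; apply: spT => i _.
  by apply/eqP; have := no i => /negP; rewrite negbK.
(* The line [x + t *: v] meets the hyperplane of [i] at [t = T i]. Minimizing the absolute value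
   picks the nearest hyperplane on either side, so that none is crossed. *)
pose T i := (h i - dot (w i) x) / dot (w i) v.
have [i hi imin] := argmin_exists (P := fun i => dot (w i) v != 0) (fun i => `|T i|) hi0.
pose y := x + T i *: v.
have yE j : dot (w j) v != 0 -> dot (w j) y - h j = dot (w j) v * (T i - T j).
  by move=> hj; rewrite dotDr dotZr mulrBr /T [X in _ = _ - X]mulrC divfK//; lra.
have xE j : dot (w j) v != 0 -> dot (w j) x - h j = dot (w j) v * (- T j).
  by move=> hj; rewrite /T mulrN [X in _ = - X]mulrC divfK//; lra.
have yx : below (sgn h y) (sgn h x).
  move=> j; have [hj|hj] := eqVneq (dot (w j) v) 0.
    by right; rewrite /sgn dotDr dotZr hj mulr0 addr0.
  rewrite /sgn yE// xE// !sgrM; have := imin j hj.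
  have [Tj|Tj|->] := ltrgtP (T j) 0; last 1 first.
  - by rewrite normr0 normr_le0 => /eqP->; left; rewrite subr0 sgr0 mulr0.
  - rewrite (ltr0_norm Tj) => /ler_normlP[+ _].
    rewrite lerN2 le_eqVlt => /orP[/eqP->|ij].
      by left; rewrite subrr sgr0 mulr0.
    by right; congr (_ * _); rewrite !gtr0_sg; lra.
  - rewrite (gtr0_norm Tj) => /ler_normlP[_]; rewrite le_eqVlt => /orP[/eqP->|ij].
      by left; rewrite subrr sgr0 mulr0.
    by right; congr (_ * _); rewrite !ltr0_sg; lra.
have [|z zy sz] := IH y.
  apply: leq_trans kx; apply: proper_card; rewrite properE finset.setCS below_tight//=.
  apply/fintype.subsetPn; exists i; rewrite !finset.in_setC; last first.
    by rewrite negbK in_tight -subr_eq0 yE// subrr mulr0.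
  by apply: contra hi => /hv/eqP.
by exists z => //; exact: below_trans yx.
Qed.

Definition polyhedron h : set V := [set x | forall i, dot (w i) x <= h i].

Definition extreme_points h : set V := [set y | polyhedron h y /\ spanning w (tight h y)].

(** Excludes recession directions: polyhedra with these normals contain no ray and are therefore
    bounded. *)
Definition positively_spanning := forall v, v != 0 -> exists i, 0 < dot (w i) v.

Lemma positively_spanning_spanning : positively_spanning -> spanning w [set: I]%SET.
Proof.
move=> ps v hv; apply/eqP/negPn/negP => /ps[i].
by rewrite hv ?finset.in_setT ?ltxx.
Qed.

(** Some constraint increases along [v], so the ray leaves the polyhedron; at the exit point a new
    constraint is tight, and the old ones stay tight because [v] is orthogonal to their normals. *)
Lemma polyhedron_ray h x v : positively_spanning -> polyhedron h x -> v != 0 ->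
  (forall i, i \in tight h x -> dot (w i) v = 0) ->
  exists t, [/\ 0 < t, polyhedron h (x + t *: v) &
    (#|~: tight h (x + t *: v)| < #|~: tight h x|)%N].
Proof.
move=> ps Px v0 hv; have [i0 hi0] := ps v v0.
pose T i := (h i - dot (w i) x) / dot (w i) v.
have [i hi imin] := argmin_exists (P := fun i => 0 < dot (w i) v) T hi0.
have ix : i \notin tight h x.
  by apply: contraTN hi => /hv->; rewrite ltxx.
have T0 : 0 < T i.
  rewrite divr_gt0// subr_gt0 lt_neqAle Px andbT.
  by move: ix; rewrite in_tight.
exists (T i); split=> //.
  move=> j; rewrite dotDr dotZr; have [vj|vj] := ltP 0 (dot (w j) v).
    by have := imin j vj; rewrite {2}/T ler_pdivlMr//; lra.
  have := Px j; have : T i * dot (w j) v <= 0 by rewrite pmulr_rle0.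
  by move=> *; lra.
apply: proper_card; rewrite properE finset.setCS; apply/andP; split.
  apply/fintype.subsetP => j jx; rewrite in_tight dotDr dotZr hv// mulr0 addr0.
  by rewrite -in_tight.
apply/fintype.subsetPn; exists i; rewrite finset.in_setC// negbK in_tight dotDr dotZr.
by rewrite /T divfK ?(gt_eqF hi)//; apply/eqP; lra.
Qed.

(** If [x] is not extreme, it lies between the exit points of the rays along [v] and [- v], both of
    which have more tight constraints; induct on the number of constraints that are not tight. *)
Lemma polyhedron_conv_hull h : positively_spanning ->
  polyhedron h = conv_hull (extreme_points h).
Proof.
move=> ps; apply/seteqP; split=> [x|x cx i]; last first.
  by apply: conv_hull_le cx => y [/(_ i)].
have [k] := ubnP #|~: tight h x|; elim: k x => // k IH x; rewrite ltnS => kx Px.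
have [sp|/not_spanning[v v0 hv]] := pselect (spanning w (tight h x)).
  by apply: sub_conv_hull.
have [t [t0 Pt ct]] := polyhedron_ray ps Px v0 hv.
have [|i ix|s [s0 Ps cs]] := polyhedron_ray (v := - v) ps Px.
- by rewrite oppr_eq0.
- by rewrite dotNr hv ?oppr0.
have c1 := IH _ (leq_trans ct kx) Pt; have c2 := IH _ (leq_trans cs kx) Ps.
have -> : x = (x + t *: v) + t / (t + s) *: ((x + s *: - v) - (x + t *: v)).
  apply/rowP => j; rewrite !mxE; field; rewrite gt_eqF//; lra.
apply: conv_hull_convex => //; rewrite divr_ge0 ?ler_pdivrMr; lra.
Qed.

(** An extreme point is determined by its tight set. *)
Lemma finite_extreme_points h : finite_set (extreme_points h).
Proof.
pose f (B : {set I}) := xget 0 [set y | extreme_points h y /\ tight h y = B].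
apply: (@sub_finite_set _ _ (f @` setT)).
  move=> y Ey; exists (tight h y) => //.
  have [[_ sp] e] : [set z | extreme_points h z /\ tight h z = tight h y] (f (tight h y)).
    by apply: xgetPex; exists y.
  by apply: (tight_spanning_inj sp); rewrite e.
by apply: finite_image; exact: finite_finset.
Qed.

Lemma polyhedron_polytope h : positively_spanning -> polytope (polyhedron h).
Proof.
move=> ps; exists (extreme_points h); split; first exact: finite_extreme_points.
exact: polyhedron_conv_hull.
Qed.

End Arrangement.

(** * Hyperplanes, facets and facet normals of polytopes *)

Section Hyperplanes.
Context {R : realType} {n : nat}.
Local Notation V := 'rV[R]_n.
Implicit Types (u v x : V) (c : R) (Q F : set V).

Lemma dot_is_linear u : linear (dot u : V -> R^o).
Proof. by move=> a x y; rewrite dotDr dotZr. Qed.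

HB.instance Definition _ u :=
  GRing.isLinear.Build R V R^o *:%R (dot u) (dot_is_linear u).

Definition orth u : {vspace V} := lker (linfun (dot u : V -> R^o)).

Lemma mem_orth u v : (v \in orth u) = (dot u v == 0).
Proof. by rewrite memv_ker lfunE. Qed.

Lemma dim_orth u : u != 0 -> (\dim (orth u)).+1 = n.
Proof.
move=> u0; have := limg_ker_dim (linfun (dot u : V -> R^o)) fullv.
rewrite capfv -/(orth u) dimvf dim_matrix mul1r.
have -> : (linfun (dot u : V -> R^o) @: fullv)%VS = fullv.
  apply/eqP; rewrite eqEsubv subvf /=; apply/subvP => a _.
  apply/memv_imgP; exists ((a / dot u u) *: u); first exact: memvf.
  by rewrite lfunE /= dotZr divfK// gt_eqF// dot_gt0.
by rewrite dimvf /= addn1.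
Qed.

Lemma hyperplane_orth u c x : dot u x = c ->
  hyperplane u c = [set x + v | v in [set` orth u]].
Proof.
move=> <-; apply/seteqP; split=> [y e|_ [v /= + <-]]; last first.
  by rewrite mem_orth /hyperplane /= dotDr => /eqP->; rewrite addr0.
exists (y - x); last by rewrite addrC subrK.
by rewrite /= mem_orth dotBr e subrr.
Qed.

Lemma has_dim_hyperplane F u c x : u != 0 -> dot u x = c ->
  aff_hull F = hyperplane u c -> exists2 d, d.+1 = n & has_dim F d.
Proof.
move=> u0 ux aF; exists (\dim (orth u)); first exact: dim_orth.
by exists x, (orth u); split => //; rewrite aF; exact: hyperplane_orth.
Qed.

(** The direction space of the hull is contained in [orth u] and has the same dimension. *)
Lemma aff_hull_hyperplane F u c d : u != 0 -> d.+1 = n -> has_dim F d ->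
  (forall x, F x -> dot u x = c) -> aff_hull F = hyperplane u c.
Proof.
move=> u0 dn [x [U [dU aF]]] Fc.
have hx v : v \in U -> dot u (x + v) = c.
  by move=> vU; apply: (aff_hull_eq Fc); rewrite aF; exists v.
have ux : dot u x = c by rewrite -[x]addr0 hx// mem0v.
suff UE : U = orth u by rewrite aF UE; exact/esym/hyperplane_orth.
apply/eqP; rewrite eqEdim; apply/andP; split.
  apply/subvP => v vU; rewrite mem_orth; have := hx v vU.
  by rewrite dotDr ux => /eqP; rewrite -subr_eq0 addrAC subrr add0r.
by rewrite dU -ltnS dim_orth// dn.
Qed.

Lemma aff_hull_full Q : has_dim Q n -> aff_hull Q = setT.
Proof.
move=> [x [U [dU ->]]].
have -> : U = fullv by apply/eqP; rewrite eqEdim subvf dU dimvf dim_matrix mul1r leqnn.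
apply/seteqP; split=> // y _; exists (y - x); last by rewrite addrC subrK.
by rewrite /= memvf.
Qed.

Lemma has_dim_full Q : aff_hull Q = setT -> has_dim Q n.
Proof.
move=> aQ; exists 0, fullv; rewrite dimvf dim_matrix mul1r; split=> //.
rewrite aQ; apply/seteqP; split=> // y _; exists y; last by rewrite add0r.
by rewrite /= memvf.
Qed.

Lemma aff_hull_nonempty Q x : aff_hull Q x -> Q !=set0.
Proof.
move=> [[|m] [v [c [hv c1 _]]]]; last by exists (v ord0).
by move: c1; rewrite big_ord0 => /esym/eqP; rewrite oner_eq0.
Qed.

Lemma full_not_hyperplane Q u c : aff_hull Q = setT -> u != 0 ->
  ~ (forall x, Q x -> dot u x = c).
Proof.
move=> aQ u0 hQ.
have h x : dot u x = c by apply: (aff_hull_eq hQ); rewrite aQ.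
by move: (h u); rewrite -(h 0) dot0r => /eqP; rewrite dot_eq0 (negPf u0).
Qed.

(** The part [z] of [u'] orthogonal to [u] can be added to a point of the first hyperplane without
    leaving it, so [u'] is orthogonal to [z] and [z] vanishes. *)
Lemma hyperplane_sub u c u' c' : dot u u = 1 -> dot u' u' = 1 ->
  hyperplane u c `<=` hyperplane u' c' -> u' = u \/ (u' = - u /\ c' = - c).
Proof.
move=> u1 u'1 sub.
have hp : dot u' (c *: u) = c' by apply: sub; rewrite /hyperplane /= dotZr u1 mulr1.
pose z := u' - dot u' u *: u.
have uz : dot u z = 0 by rewrite dotBr dotZr u1 mulr1 dotC subrr.
have u'z : dot u' z = 0.
  have : dot u' (c *: u + z) = c'.
    by apply: sub; rewrite /hyperplane /= dotDr dotZr u1 uz mulr1 addr0.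
  by rewrite dotDr hp => /eqP; rewrite -subr_eq0 addrAC subrr add0r => /eqP.
have /eqP : dot z z = 0 by rewrite {1}/z dotBl dotZl uz u'z mulr0 subrr.
rewrite dot_eq0 subr_eq0 => /eqP u'E.
have /eqP : (dot u' u) ^+ 2 = 1.
  by move: u'1; rewrite {2}u'E dotZr -expr2.
rewrite sqrf_eq1 => /orP[/eqP e|/eqP e].
  by left; rewrite u'E e scale1r.
by right; split; [rewrite u'E e scaleN1r|rewrite -hp dotZr e mulrN1].
Qed.

(** Opposite normals would squeeze [Q] into a hyperplane, against full dimension. *)
Lemma normal_unique Q F u c u' c' : aff_hull Q = setT ->
  dot u u = 1 -> dot u' u' = 1 ->
  (forall x, Q x -> dot u x <= c) -> (forall x, Q x -> dot u' x <= c') ->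
  aff_hull F = hyperplane u c -> F `<=` hyperplane u' c' -> u' = u.
Proof.
move=> aQ u1 u'1 hc hc' aF Fu'.
have [x|//|[u'E c'E]] := @hyperplane_sub u c u' c' u1 u'1.
  by rewrite -aF; exact: aff_hull_eq.
exfalso; apply: (full_not_hyperplane aQ (unit_neq0 u1) (c := c)) => x Qx.
by apply/le_anti; rewrite hc//= -lerN2 -dotNl -u'E -c'E hc'.
Qed.

Lemma normals_intro Q u c : u != 0 -> (forall x, Q x -> dot u x <= c) ->
  aff_hull (Q `&` hyperplane u c) = hyperplane u c ->
  normals Q ((enorm u)^-1 *: u).
Proof.
move=> u0 hc aF.
have ux : dot u ((c / dot u u) *: u) = c by rewrite dotZr divfK// gt_eqF// dot_gt0.
have [y [Qy uy]] : (Q `&` hyperplane u c) !=set0.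
  by apply: (@aff_hull_nonempty _ ((c / dot u u) *: u)); rewrite aF.
exists (Q `&` hyperplane u c).
  split; last exact: (has_dim_hyperplane u0 ux).
  exists u => //; apply/seteqP; split=> [x [Qx e]|x [Qx mx]].
    by split=> // z Qz; rewrite e hc.
  by split=> //; apply/le_anti; rewrite hc//= -uy mx.
split; first exact: enorm_normalize.
have e0 : 0 < (enorm u)^-1 by rewrite invr_gt0 enorm_gt0.
exists ((enorm u)^-1 * c); split=> [x Qx|x [Qx e]].
  by rewrite dotZl ler_pM2l// hc.
by rewrite dotZl e.
Qed.

Lemma normalsP Q u : normals Q u -> exists F c,
  [/\ dot u u = 1, facet Q F, forall x, Q x -> dot u x <= c,
      forall x, F x -> Q x /\ dot u x = c & aff_hull F = hyperplane u c].
Proof.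
move=> [F fF [/enorm1 u1 [c [hc Fc]]]]; exists F, c; split=> //.
  by case: fF => [[v v0 FE] _] x Fx; split; [move: Fx; rewrite FE => -[]|exact: Fc].
case: fF => _ [d dn dF]; apply: (aff_hull_hyperplane _ dn) => //.
exact: unit_neq0.
Qed.

Lemma facet_normal Q F : facet Q F ->
  exists2 u, normals Q u & outward_unit_normal Q F u.
Proof.
move=> fF; suff [u hu] : exists u, outward_unit_normal Q F u.
  by exists u => //; exists F.
case: (fF) => [[v v0 FE] [d dn [x0 [U [_ aF]]]]].
have [x Fx] : F !=set0.
  by apply: (@aff_hull_nonempty _ (x0 + 0)); rewrite aF; exists 0 => //=; rewrite mem0v.
exists ((enorm v)^-1 *: v); split; first exact: enorm_normalize.
have e0 : 0 < (enorm v)^-1 by rewrite invr_gt0 enorm_gt0.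
exists ((enorm v)^-1 * dot v x); split=> y.
  by move: Fx; rewrite FE dotZl ler_pM2l// => -[_ +]; exact.
move: Fx; rewrite FE dotZl => -[Qx mx] [Qy my]; congr (_ * _).
by apply/le_anti; rewrite mx// my.
Qed.

Lemma finite_range (A : set V) : finite_set A ->
  exists (I : finType) (a : I -> V), injective a /\ A = range a.
Proof.
move=> /finite_seqP[s ->]; exists (seq_sub s), (@ssval _ s).
split; first exact: val_inj.
apply/seteqP; split=> [x xs|_ [[x xs] _ <-]//].
by exists (SeqSub xs).
Qed.

(** A facet normal is determined by the set [T u] of generators that maximize it, and there are
    finitely many such sets. *)
Lemma polytope_finite_normals Q : polytope Q -> has_dim Q n -> finite_set (normals Q).
Proof.
move=> [A [/finite_range[I [a [_ ->]]] QE]] /aff_hull_full aQ.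
have Qa i : Q (a i) by rewrite QE; apply: sub_conv_hull; exists i.
pose T u : {set I} := [set i | `[< forall x, Q x -> dot u x <= dot u (a i) >]]%SET.
have inj u u' : normals Q u -> normals Q u' -> T u = T u' -> u' = u.
  move=> /normalsP[F [c [u1 _ hc Fc aF]]] /normalsP[F' [c' [u'1 _ hc' F'c' aF']]] TT.
  have [y' F'y'] : F' !=set0.
    apply: (@aff_hull_nonempty _ (c' *: u')); rewrite aF'.
    by rewrite /hyperplane /= dotZr u'1 mulr1.
  have inT i : dot u (a i) = c -> dot u' (a i) = c'.
    move=> ai; have : i \in T u.
      by rewrite finset.in_set; apply/asboolP => x Qx; rewrite ai hc.
    rewrite TT finset.in_set => /asboolP /(_ y') h.
    have [Qy' y'c'] := F'c' _ F'y'.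
    by apply/le_anti; rewrite hc'//= -y'c' h.
  apply: (normal_unique aQ u1 u'1 hc hc' aF) => x Fx.
  have [+ xc] := Fc _ Fx; rewrite QE => -[m [v [k [hv k0 k1 xE]]]].
  (* Complementary slackness: a point of the facet puts weight only on generators that lie in the
     facet. *)
  have kv i : k i * (c - dot u (v i)) = 0.
    have : \sum_i k i * (c - dot u (v i)) == 0.
      under eq_bigr do rewrite mulrBr.
      rewrite sumrB -mulr_suml k1 mul1r subr_eq0 -xc {1}xE dot_sumr.
      by apply/eqP/eq_bigr => j _; rewrite dotZr.
    rewrite psumr_eq0 => [/allP h|j _]; last first.
      by rewrite mulr_ge0// subr_ge0 hc// QE; apply: sub_conv_hull.
    by have /eqP := h i (mem_index_enum _).
  rewrite /hyperplane /= xE dot_sumr -[c']mul1r -k1 mulr_suml; apply: eq_bigr => i _.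
  rewrite dotZr; have /eqP := kv i; rewrite mulf_eq0 => /orP[/eqP->|].
    by rewrite !mul0r.
  by rewrite subr_eq0 => /eqP/esym; have [j _ <-] := hv i => /inT->.
pose f (B : {set I}) := xget 0 [set u | normals Q u /\ T u = B].
apply: (@sub_finite_set _ _ (f @` setT)).
  move=> u Nu; exists (T u) => //.
  have [Nf Tf] : [set v | normals Q v /\ T v = T u] (f (T u)).
    by apply: xgetPex; exists u.
  exact: inj.
by apply: finite_image; exact: finite_finset.
Qed.

(* Facets of [Q] are read off the vertices of its polar about an interior point. *)
Lemma polytope_normals_pos Q v : polytope Q -> has_dim Q n -> v != 0 ->
  exists2 u, normals Q u & 0 < dot u v.
Proof.
move=> [A [/finite_range[I [a [_ ->]]] QE]] /aff_hull_full aQ v0.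
have Qa i : Q (a i) by rewrite QE; apply: sub_conv_hull; exists i.
have [i0] : exists i : I, True.
  have [y] : Q !=set0 by apply: (@aff_hull_nonempty _ 0); rewrite aQ.
  rewrite QE => -[[|m] [z [c [hz _ c1 _]]]].
    by move: c1; rewrite big_ord0 => /esym/eqP; rewrite oner_eq0.
  by have [i _ _] := hz ord0; exists i.
move=> _.
have I0 : #|I|%:R != 0 :> R.
  by rewrite pnatr_eq0 -lt0n; apply/card_gt0P; exists i0.
pose x0 := (#|I|%:R)^-1 *: \sum_i a i.
(* With the barycenter as center the shifted generators add up to 0, so a vector with no positive
   product is orthogonal to all of them and [Q] would be flat. *)
pose w i := a i - x0.
have w_sum : \sum_i w i = 0.
  rewrite sumrB sumr_const /x0 -scaler_nat scalerA mulfV// scale1r.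
  exact: subrr.
have ps : positively_spanning w.
  move=> z z0; apply: contrapT => /forallNP no.
  have {}no i : dot (w i) z <= 0 by rewrite leNgt; apply/negP.
  have : \sum_i - dot (w i) z == 0 by rewrite sumrN -dot_suml w_sum dot0l oppr0.
  rewrite psumr_eq0 => [/allP h|i _]; last by rewrite oppr_ge0.
  have {}h i : dot z (a i) = dot z x0.
    have := h i (mem_index_enum _); rewrite /= oppr_eq0 dotBl subr_eq0.
    by rewrite !(dotC _ z) => /eqP.
  apply: (full_not_hyperplane aQ z0 (c := dot z x0)) => x; rewrite QE => cx.
  apply/le_anti/andP; split; first by apply: conv_hull_le cx => _ [i _ <-]; rewrite h.
  rewrite -lerN2 -!dotNl; apply: conv_hull_le cx => _ [i _ <-].
  by rewrite !dotNl h.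
have [t t0 ht] : exists2 t : R, 0 < t & polyhedron w (fun=> 1) (t *: v).
  apply: small_ex; apply: small_forall => i.
  have [e e0 he] := @small_lt R 0 1 (dot (w i) v) 0 ltr01; exists e => // s /he.
  by rewrite add0r mulr0 addr0 dotZr => /ltW.
(* A small multiple of [v] lies in the polar and has a positive product with [v]; hence so does some
   vertex of the polar. *)
have [u [Pu su] vu] : exists2 u, extreme_points w (fun=> 1) u & 0 < dot v u.
  apply: contrapT => /forall2NP no.
  have : dot v (t *: v) <= 0.
    move: ht; rewrite (polyhedron_conv_hull _ ps); apply: conv_hull_le => y ey.
    by case: (no y) => // /negP; rewrite -leNgt.
  by rewrite dotZr leNgt mulr_gt0// dot_gt0.
have u0 : u != 0 by apply: contraTneq vu => ->; rewrite dot0r ltxx.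
exists ((enorm u)^-1 *: u); last first.
  by rewrite dotZl mulr_gt0 ?invr_gt0 ?enorm_gt0// dotC.
apply: (normals_intro (c := dot u x0 + 1)) => //.
  move=> x; rewrite QE; apply: conv_hull_le => _ [i _ <-].
  by have := Pu i; rewrite dotBl !(dotC _ u); lra.
apply/seteqP; split=> [x|x hx].
  by apply: aff_hull_eq => y [].
have [B /fintype.subsetP Bt bB] := basis_exists su.
have xE : x - x0 = \sum_(b in B) dot (dual w B b) (x - x0) *: w b.
  exact: basis_expand_dual.
(* On the hyperplane of [u] the coordinates with respect to tight shifted generators add up to 1,
   which makes the expansion an affine combination of points of the facet. *)
have s1 : \sum_(b in B) dot (dual w B b) (x - x0) = 1.
  have : dot u (x - x0) = 1 by rewrite dotBr hx addrAC subrr add0r.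
  rewrite {1}xE dot_sumr => <-; apply: eq_bigr => b /Bt.
  by rewrite in_tight dotZr dotC => /eqP; rewrite (dotC u) => ->; rewrite mulr1 dotC.
have -> : x = \sum_(b in B) dot (dual w B b) (x - x0) *: a b.
  rewrite -[LHS](subrK x0) {1}xE.
  under eq_bigr do rewrite scalerBr.
  by rewrite sumrB -scaler_suml s1 scale1r subrK.
apply: aff_hull_sum => // b /Bt; rewrite in_tight => /eqP e.
by split=> //; move: e; rewrite /hyperplane /= dotBl !(dotC _ u); lra.
Qed.

End Hyperplanes.

(** * Admissible offsets and the polytopes they define *)

Section Valid.
Context {R : realType} {n : nat} {I : finType}.
Local Notation V := 'rV[R]_n.
Variable w : I -> V.
Implicit Types (h g : I -> R) (Q : set V).

(* [valid h] says that all [w i] are facet normals of the polyhedron with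
   offsets [h], which is full-dimensional. *)
Definition valid h :=
  (forall i, exists2 y, dot (w i) y = h i & forall j, j != i -> dot (w j) y < h j) /\
  (exists x, forall i, dot (w i) x < h i).

Definition hyperplanes h : set (set V) := [set hyperplane (w i) (h i) | i in setT].

Hypothesis w1 : forall i, dot (w i) (w i) = 1.
Hypothesis w_inj : injective w.

Lemma valid_convex h g (t : R) : valid h -> valid g -> 0 <= t <= 1 ->
  valid (fun i => h i + t * (g i - h i)).
Proof.
move=> [hf [x hx]] [gf [y gy]] /andP[t0 t1].
have lt (a b c d : R) : a < b -> c < d -> a + t * (c - a) < b + t * (d - b).
  move=> ab cd; rewrite -subr_gt0.
  have -> : b + t * (d - b) - (a + t * (c - a)) = (1 - t) * (b - a) + t * (d - c) by ring.
  have [->|tn0] := eqVneq t 0; first lra.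
  have t0' : 0 < t by rewrite lt_def tn0.
  by apply: ltr_wpDl; [apply: mulr_ge0; lra|apply: mulr_gt0; lra].
split=> [i|].
  have [a ai aj] := hf i; have [b bi bj] := gf i.
  exists (a + t *: (b - a)); first by rewrite dotDr dotZr dotBr ai bi.
  by move=> j ji; rewrite dotDr dotZr dotBr lt ?aj ?bj.
by exists (x + t *: (y - x)) => i; rewrite dotDr dotZr dotBr lt.
Qed.

(** Finitely many strict inequalities survive a small change; the witness of facet [i] is shifted
    along its unit normal to follow the moving hyperplane. *)
Lemma valid_perturb h g : valid h -> small (fun t => valid (fun i => h i + t * g i)).
Proof.
move=> [hf [x hx]]; have [y hy] := choice (fun i => let: ex_intro2 y a b := hf i in
  ex_intro (fun y => dot (w i) y = h i /\ forall j, j != i -> dot (w j) y < h j) y (conj a b)).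
have [e e0 he] : small (fun t => forall p : I * I, p.2 != p.1 ->
    dot (w p.2) (y p.1) + t * (g p.1 * dot (w p.2) (w p.1)) < h p.2 + t * g p.2).
  apply: small_forall => -[i j] /=; have [ji|ji] := eqVneq j i; first by exists 1.
  have [e e0 he] := small_lt (g i * dot (w j) (w i)) (g j) ((hy i).2 j ji).
  by exists e => // t te _; apply: he.
have [d d0 hd] : small (fun t => forall i, dot (w i) x < h i + t * g i).
  apply: small_forall => i; have [d d0 hd] := small_lt 0 (g i) (hx i).
  by exists d => // t /hd; rewrite mulr0 addr0.
have [c c0 hc] := small_and (ex_intro2 _ _ e e0 he) (ex_intro2 _ _ d d0 hd).
exists c => // t /hc[h1 h2]; split; last by exists x.
move=> i; exists (y i + (t * g i) *: w i).
  by rewrite dotDr dotZr w1 mulr1 (hy i).1.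
by move=> j ji; have := h1 (i, j) ji; rewrite /= dotDr dotZr mulrA.
Qed.

(** These are the values of the support function of the unit balls around the points [c l]. The
    contact point [c (k i) + w i] lies on the hyperplane of [i] alone, because distinct unit vectors
    have inner product below 1. *)
Lemma valid_support (K : finType) (c : K -> V) (k : I -> K) (k0 : K) :
  (forall i l, dot (w i) (c l) <= dot (w i) (c (k i))) ->
  valid (fun i => dot (w i) (c (k i)) + 1).
Proof.
move=> hk; split=> [i|]; last first.
  by exists (c k0) => i; rewrite ltr_pwDr.
exists (c (k i) + w i); first by rewrite dotDr w1.
move=> j ji; rewrite dotDr; apply: ler_ltD => //.
by apply: dot_unit_lt1 => //; rewrite (inj_eq w_inj).
Qed.

(** Passes from a given polytope to offsets; the witnesses required by [valid] are a relative
    interior point of each facet and an interior point of [Q]. *)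
Lemma facet_offsets Q : convex Q -> has_dim Q n -> normals Q = range w ->
  exists2 h, facet_arrangement Q = hyperplanes h & valid h /\
    forall i, (forall x, Q x -> dot (w i) x <= h i) /\ (exists2 x, Q x & dot (w i) x = h i).
Proof.
move=> cQ /aff_hull_full aQ NQ.
have : forall i, exists c, exists F, [/\ facet Q F, forall x, Q x -> dot (w i) x <= c,
      forall x, F x -> Q x /\ dot (w i) x = c & aff_hull F = hyperplane (w i) c].
  move=> i; have /normalsP[F [c [_ fF hc Fc aF]]] : normals Q (w i) by rewrite NQ; exists i.
  by exists c, F.
move=> /choice[h /choice[F hF]].
have F0 i : F i !=set0.
  have [_ _ _ aF] := hF i; apply: (@aff_hull_nonempty _ _ _ (h i *: w i)).
  by rewrite aF /hyperplane /= dotZr w1 mulr1.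
have hb i : (forall x, Q x -> dot (w i) x <= h i) /\ (exists2 x, Q x & dot (w i) x = h i).
  have [_ hc Fc _] := hF i; split=> //.
  by have [x /Fc[]] := F0 i; exists x.
exists h.
- apply/seteqP; split=> [_ [G fG <-]|_ [i _ <-]]; last first.
    by have [fF _ _ aF] := hF i; exists (F i).
  have [u Nu [/enorm1 u1 [c [hc Gc]]]] := facet_normal fG.
  move: Nu; rewrite NQ => -[i _ iu]; exists i => //.
  have [_ [d dn dG]] := fG.
  rewrite (aff_hull_hyperplane (unit_neq0 u1) dn dG Gc) -iu; congr hyperplane.
  have [y Gy] : G !=set0.
    apply: (@aff_hull_nonempty _ _ _ (c *: u)).
    by rewrite (aff_hull_hyperplane (unit_neq0 u1) dn dG Gc) /hyperplane /= dotZr u1 mulr1.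
  have Qy : Q y by case: fG => [[v _ GE] _]; move: Gy; rewrite GE => -[].
  have [hci [x Qx xi]] := hb i.
  (* Both offsets bound [dot u] on [Q] and both are attained. *)
  apply/le_anti; rewrite -{1}xi iu hc//= -(Gc _ Gy) -iu; exact: hci.
- split=> //; split=> [i|]; last first.
    have [x _ hx] : exists2 x, Q x & forall i, i \in enum I -> dot (w i) x < h i.
      apply: convex_strict_point => //.
      + by apply: (@aff_hull_nonempty _ _ _ 0); rewrite aQ.
      + by move=> i x _; exact: (hb i).1.
      + move=> i _; apply: contrapT => /forall2NP no.
        apply: (full_not_hyperplane aQ (unit_neq0 (w1 i)) (c := h i)) => x Qx.
        apply/le_anti; rewrite (hb i).1//= leNgt; apply/negP => lx.
        by case: (no x).
    by exists x => i; apply: hx; rewrite mem_enum.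
  have [[[v v0 FE] _] hc Fc aF] := hF i.
  have [x Fx hx] : exists2 x, F i x &
      forall j, j \in [seq j <- enum I | j != i] -> dot (w j) x < h j.
    apply: convex_strict_point => //.
    + by rewrite FE; exact: support_face_convex.
    + by move=> j x _ /Fc[Qx _]; exact: (hb j).1.
    (* If constraint [j] were tight on all of facet [i], this facet would have two normals. *)
    + move=> j; rewrite mem_filter => /andP[ji _]; apply: contrapT => /forall2NP no.
      move/eqP: ji; apply; apply: w_inj.
      apply: (normal_unique aQ (w1 i) (w1 j) hc (hb j).1 aF) => x Fx.
      have [Qx _] := Fc x Fx.
      apply/le_anti; rewrite (hb j).1//= leNgt; apply/negP => lx.
      by case: (no x).
  exists x; first by have [] := Fc x Fx.
  by move=> j ji; apply: hx; rewrite mem_filter ji mem_enum.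
Qed.

Lemma strict_small h x v : (forall i, dot (w i) x < h i) ->
  small (fun t => polyhedron w h (x + t *: v)).
Proof.
move=> hx; apply: small_forall => i.
have [e e0 he] := small_lt (dot (w i) v) 0 (hx i); exists e => // t /he.
by rewrite mulr0 addr0 dotDr dotZr => /ltW.
Qed.

Lemma polyhedron_full h : valid h -> has_dim (polyhedron w h) n.
Proof.
move=> [_ [x hx]]; apply: has_dim_full; apply/seteqP; split=> // z _.
have [t t0 ht] := small_ex (strict_small (z - x) hx).
have -> : z = x + t^-1 *: ((x + t *: (z - x)) - x).
  by apply/rowP => k; rewrite !mxE; field; rewrite gt_eqF.
by apply: aff_hull_line => // i; exact: ltW.
Qed.

Lemma polyhedron_convex h : convex (polyhedron w h).
Proof.
move=> x y t Px Py /andP[t0 t1] i; rewrite dotDr dotZr dotBr.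
rewrite -subr_ge0.
have -> : h i - (dot (w i) x + t * (dot (w i) y - dot (w i) x)) =
  (1 - t) * (h i - dot (w i) x) + t * (h i - dot (w i) y) by ring.
by rewrite addr_ge0// mulr_ge0// subr_ge0.
Qed.

(** A facet with any other normal [u] would contain a point strictly inside all constraints, from
    which a step along [u] stays in the polyhedron. Conversely, around a point that lies on the
    hyperplane of [i] alone the facet contains all directions of that hyperplane. *)
Lemma polyhedron_normals h : valid h -> normals (polyhedron w h) = range w.
Proof.
move=> vh; have aQ := aff_hull_full (polyhedron_full vh); have [hf [x0 hx0]] := vh.
apply/seteqP; split=> [u /normalsP[F [c [u1 fF hc Fc aF]]]|_ [i _ <-]].
  apply: contrapT => nu.
  have [x Fx hx] : exists2 x, F x & forall i, i \in enum I -> dot (w i) x < h i.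
    apply: convex_strict_point => //.
    - case: fF => [[v _ ->] _]; apply: support_face_convex; exact: polyhedron_convex.
    - by apply: (@aff_hull_nonempty _ _ _ (c *: u)); rewrite aF /hyperplane /= dotZr u1 mulr1.
    - by move=> i x _ /Fc[Px _]; exact: Px.
    - move=> i _; apply: contrapT => /forall2NP no; apply: nu; exists i => //.
      apply: (normal_unique (c' := h i) aQ u1 (w1 i) hc _ aF) => [x Px|x Fx]; first exact: Px.
      have [Px _] := Fc x Fx.
      apply/le_anti; rewrite Px/= leNgt; apply/negP => lx.
      by case: (no x).
  have {}hx i : dot (w i) x < h i by apply: hx; rewrite mem_enum.
  have [t t0 /hc] := small_ex (strict_small u hx).
  by have [_ xc] := Fc x Fx; rewrite dotDr dotZr u1 xc; lra.
have e1 : enorm (w i) = 1 by rewrite /enorm w1 sqrtr1.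
rewrite -[w i]scale1r -[X in X *: _]invr1 -e1.
apply: (normals_intro (c := h i)); first exact: unit_neq0.
  by move=> x; exact.
apply/seteqP; split=> [x|z hz]; first by apply: aff_hull_eq => y [].
have [y yi yj] := hf i.
have Py : polyhedron w h y.
  by move=> j; have [->|/yj/ltW//] := eqVneq j i; rewrite yi.
have [t t0 ht] : exists2 t, 0 < t & polyhedron w h (y + t *: (z - y)).
  apply/small_ex/small_forall => j; have [->|ji] := eqVneq j i.
    by exists 1 => // t _; rewrite dotDr dotZr dotBr hz yi subrr mulr0 addr0.
  have [e e0 he] := small_lt (dot (w j) (z - y)) 0 (yj j ji); exists e => // t /he.
  by rewrite mulr0 addr0 (dotDr _ y) dotZr => /ltW.
have -> : z = y + t^-1 *: ((y + t *: (z - y)) - y).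
  by apply/rowP => k; rewrite !mxE; field; rewrite gt_eqF.
apply: aff_hull_line => //; split=> //.
by rewrite /hyperplane /= dotDr dotZr dotBr hz yi subrr mulr0 addr0.
Qed.

Lemma polyhedron_arrangement h : valid h ->
  facet_arrangement (polyhedron w h) = hyperplanes h.
Proof.
move=> vh; have [hf _] := vh.
have [h' -> [_ hb]] :=
  facet_offsets (@polyhedron_convex h) (polyhedron_full vh) (polyhedron_normals vh).
congr hyperplanes; apply/funext => i.
have [hle [x Px xi]] := hb i; have [y yi yj] := hf i.
apply/le_anti; rewrite -{1}xi Px/= -yi hle// => j.
by have [->|/yj/ltW//] := eqVneq j i; rewrite yi.
Qed.

End Valid.

(** * Cells of an arrangement in terms of sign vectors *)

Section Cells.
Context {R : realType} {n : nat}.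
Local Notation V := 'rV[R]_n.

Lemma dot_continuous (u : V) : continuous (dot u).
Proof.
rewrite /dot; apply: continuous_big; first exact: add_continuous.
move=> i _ x; apply: (@continuous_comp _ _ _ (fun x : V => x 0 i) ( *%R (u 0 i))).
  exact: coord_continuous.
exact: mulrl_continuous.
Qed.

Lemma same_positionP (u : V) (c : R) x y :
  same_position (hyperplane u c) x y <-> Num.sg (dot u x - c) = Num.sg (dot u y - c).
Proof.
have cx : conv_hull [set x; y] x by apply: sub_conv_hull; left.
have cy : conv_hull [set x; y] y by apply: sub_conv_hull; right.
split=> [[[-> ->]//|e]|].
  have ne z : conv_hull [set x; y] z -> dot u z != c.
    by move=> cz; apply/negP => /eqP zc; have : set0 z by rewrite -e.
  clear e.
  have /lt_total := ne _ cx; have /lt_total := ne _ cy.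
  move=> /orP[yc|yc] /orP[xc|xc].
  - by rewrite !ltr0_sg ?subr_lt0.
  (* [z] is the point where the segment crosses the hyperplane. *)
  - pose z := x + ((dot u x - c) / (dot u x - dot u y)) *: (y - x).
    have /ne : conv_hull [set x; y] z.
      by apply: conv_hull_convex => //; rewrite divr_ge0 ?ler_pdivrMr; lra.
    have -> : dot u z = c by rewrite dotDr dotZr dotBr; field; lra.
    by rewrite eqxx.
  - pose z := x + ((c - dot u x) / (dot u y - dot u x)) *: (y - x).
    have /ne : conv_hull [set x; y] z.
      by apply: conv_hull_convex => //; rewrite divr_ge0 ?ler_pdivrMr; lra.
    have -> : dot u z = c by rewrite dotDr dotZr dotBr; field; lra.
    by rewrite eqxx.
  - by rewrite !gtr0_sg ?subr_gt0.
have [xc|] := eqVneq (dot u x) c.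
  rewrite xc subrr sgr0 => /esym/eqP; rewrite sgr_eq0 subr_eq0 => /eqP yc.
  by left.
move=> /lt_total /orP[xc|xc] e; right; apply/seteqP; split=> // z [cz zc].
- have yc : dot u y < c by rewrite -subr_lt0 -sgr_lt0 -e sgr_lt0 subr_lt0.
  have : dot u z <= Num.max (dot u x) (dot u y).
    by apply: conv_hull_le cz => _ [->|->]; rewrite le_max lexx ?orbT.
  by rewrite zc leNgt gt_max xc yc.
- have yc : c < dot u y by rewrite -subr_gt0 -sgr_gt0 -e sgr_gt0 subr_gt0.
  have : dot (- u) z <= Num.max (dot (- u) x) (dot (- u) y).
    by apply: conv_hull_le cz => _ [->|->]; rewrite le_max lexx ?orbT.
  by rewrite !dotNl zc leNgt gt_max !ltrN2 xc yc.
Qed.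

Context {I : finType}.
Variable w : I -> V.
Implicit Types (h : I -> R) (x y : V).

Definition cell h x : set V := [set y | below (sgn w h y) (sgn w h x)].

Lemma open_cellE h x : open_cell (hyperplanes w h) x = [set y | sgn w h y = sgn w h x].
Proof.
apply/seteqP; split=> [y hy|y e _ [i _ <-]].
  by apply/funext => i; apply/esym/same_positionP; apply: hy; exists i.
by apply/same_positionP; have := congr1 (@^~ i) e.
Qed.

(** Nonzero signs are locally constant, which bounds the closure. Conversely, if [y] is below [x],
    the points strictly between [y] and [x] have the sign vector of [x] and come arbitrarily close
    to [y]. *)
Lemma closure_open_cell h x : closure (open_cell (hyperplanes w h) x) = cell h x.
Proof.
rewrite open_cellE; apply/seteqP; split=> [y cy i|y yx B /nbhs_ballP[e /= e0 eB]].
  have [y0|y0] := eqVneq (sgn w h y i) 0; [by left|right].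
  have : nbhs y [set z | sgn w h z i = sgn w h y i].
    move: y0; rewrite sgn_eq0 in_tight => /lt_total/orP[yi|yi].
      apply: filterS (cvgr_lt _ (@dot_continuous (w i) y) _ yi) => z zi /=.
      by rewrite /sgn !ltr0_sg ?subr_lt0.
    apply: filterS (cvgr_gt _ (@dot_continuous (w i) y) _ yi) => z zi /=.
    by rewrite /sgn !gtr0_sg ?subr_gt0.
  by move=> /cy[z [/= <- <-]].
have [t t0 [t1 tB]] : exists2 t, 0 < t & t < 1 /\ B (y + t *: (x - y)).
  apply: small_ex; apply: small_and; first by exists 1 => // t /andP[].
  have [d d0 hd] : small (fun t => forall k, t * `|x 0 k - y 0 k| < e).
    apply: small_forall => k.
    have [d d0 hd] := small_lt (`|x 0 k - y 0 k|) 0 e0; exists d => // t /hd.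
    by rewrite add0r mulr0 addr0.
  exists d => // t td; apply: eB; split=> // i k; rewrite ord1.
  rewrite /ball /= !mxE opprD addrA subrr add0r normrN normrM gtr0_norm; last by case/andP: td.
  exact: hd.
exists (y + t *: (x - y)); split=> //; apply/funext => i.
rewrite /sgn dotDr dotZr dotBr.
have -> : dot (w i) y + t * (dot (w i) x - dot (w i) y) - h i =
  (1 - t) * (dot (w i) y - h i) + t * (dot (w i) x - h i) by ring.
have [/eqP|e1] := yx i.
  by rewrite /sgn sgr_eq0 => /eqP->; rewrite mulr0 add0r sgrM gtr0_sg// mul1r.
have t1' : 0 < 1 - t by rewrite subr_gt0.
move: e1; rewrite /sgn; have [xi|xi|->] := ltrgtP (dot (w i) x - h i) 0.
- rewrite (ltr0_sg xi) => /eqP; rewrite sgr_cp0 => yi; apply: ltr0_sg.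
  by rewrite -(addr0 0) ltrD// pmulr_rlt0.
- rewrite (gtr0_sg xi) => /eqP; rewrite sgr_cp0 => yi; apply: gtr0_sg.
  by rewrite addr_gt0// mulr_gt0.
- by rewrite sgr0 => /eqP; rewrite sgr_eq0 => /eqP->; rewrite !mulr0 addr0 sgr0.
Qed.

Lemma cellsE h : cells (hyperplanes w h) = [set cell h x | x in setT].
Proof.
by apply/seteqP; split=> _ [x _ <-]; exists x => //; rewrite closure_open_cell.
Qed.

Lemma cell_sub h x y : cell h x `<=` cell h y <-> below (sgn w h x) (sgn w h y).
Proof.
split=> [|xy z zx]; first by apply; exact: belowxx.
exact: below_trans xy.
Qed.

Lemma cell_inj h x y : cell h x = cell h y -> sgn w h x = sgn w h y.
Proof. by move=> e; apply: below_anti; apply/cell_sub; rewrite e. Qed.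

Lemma equivalent_hyperplanes h g :
  (forall x, exists y, sgn w g y = sgn w h x) ->
  (forall y, exists x, sgn w h x = sgn w g y) ->
  combinatorially_equivalent (hyperplanes w h) (hyperplanes w g).
Proof.
move=> /choice[t ht] hg.
(* A representative point of each cell; its sign vector does not depend on the choice. *)
pose r (C : set V) := xget 0 [set x | cell h x = C].
have rE x : sgn w h (r (cell h x)) = sgn w h x.
  by apply: cell_inj; apply: (@xgetPex _ 0 [set z | cell h z = cell h x]); exists x.
have mono x y : cell g (t (r (cell h x))) `<=` cell g (t (r (cell h y))) <->
    cell h x `<=` cell h y by rewrite !cell_sub !ht !rE.
exists (fun C => cell g (t (r C))); rewrite !cellsE; split; last first.
  by move=> _ _ [x _ <-] [y _ <-]; exact: mono.
split=> [_ [x _ <-]||_ [y _ <-]]; first by exists (t (r (cell h x))).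
  move=> _ _ /set_mem[x _ <-] /set_mem[y _ <-] e.
  by apply/seteqP; split; apply/mono; rewrite e.
have [x hx] := hg y; exists (cell h x); first by exists x.
by rewrite /cell ht rE hx.
Qed.

(** Uses only inclusion of cells, so every combinatorial equivalence preserves it. *)
Definition minimal_cell (A : set (set V)) C :=
  cells A C /\ forall D, cells A D -> D `<=` C -> D = C.

(** Every cell contains a point whose tight normals span, and the cell of such a point is a
    singleton. *)
Lemma minimal_cellE h C : spanning w [set: I]%SET ->
  minimal_cell (hyperplanes w h) C <-> exists2 B, is_basis w B & C = [set vertex w B h].
Proof.
move=> sp.
have vcell y : spanning w (tight w h y) -> cell h y = [set y].
  move=> sy; apply/seteqP; split=> [z zy|_ ->]; last exact: belowxx.
  exact/esym/(tight_spanning_inj sy)/below_tight.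
split=> [|[B bB ->]].
  rewrite /minimal_cell cellsE => -[[x _ <-] hm].
  have [y yx sy] := vertex_below h x sp.
  have [B /fintype.subsetP By bB] := basis_exists sy.
  have yE : y = vertex w B h.
    by apply: vertex_unique => // i /By; rewrite in_tight => /eqP.
  exists B => //; rewrite -yE.
  by rewrite -vcell//; apply/esym/hm; [exists y|exact/cell_sub].
have sv : spanning w (tight w h (vertex w B h)).
  move=> v hv; apply: (basis_spanning bB) => i iB; apply: hv.
  by rewrite in_tight vertexP.
rewrite /minimal_cell cellsE; split; first by exists (vertex w B h) => //; exact: vcell.
move=> _ [x _ <-] xv; apply/seteqP; split=> // _ ->.
have xx : cell h x x by exact: belowxx.
by rewrite -[X in cell h x X](xv _ xx).
Qed.

End Cells.

(** * Farkas' lemma *)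

Section Farkas.
Context {R : realType} {n : nat}.
Local Notation V := 'rV[R]_n.

(** Induction on the number of vectors: if the vector [d] found for the others fails on [v0],
    project along [v0] onto the orthogonal complement of [d] and apply the induction hypothesis
    again. *)
Lemma farkas k (v : 'I_k -> V) (u : V) :
  (exists2 c : 'I_k -> R, forall i, 0 <= c i & u = \sum_i c i *: v i) \/
  (exists2 d, 0 < dot u d & forall i, dot (v i) d <= 0).
Proof.
elim: k v u => [|k IH] v u.
  have [->|u0] := eqVneq u 0; [left|right].
    by exists (fun=> 0) => //; rewrite big_ord0.
  by exists u => [|[]//]; rewrite dot_gt0.
pose v0 := v ord0; pose vs i := v (lift ord0 i).
have [[c c0 uE]|[d ud vd]] := IH vs u.
  left; exists (fun i => if unlift ord0 i is Some j then c j else 0) => [i|].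
    by case: unlift.
  rewrite big_ord_recl unlift_none scale0r add0r uE.
  by apply: eq_bigr => i _; rewrite liftK.
have [v0d|v0d] := leP (dot v0 d) 0.
  right; exists d => // i; case: (unliftP ord0 i) => [j ->|->//]; exact: vd.
pose p z := z - (dot z d / dot v0 d) *: v0.
have [[c c0 uE]|[e ue ve]] := IH (fun i => p (vs i)) (p u).
  (* Undoing the projection leaves [v0] with coefficient [a], which is nonnegative by the signs of
     the products with [d]. *)
  left; pose a := dot u d / dot v0 d - \sum_i c i * (dot (vs i) d / dot v0 d).
  exists (fun i => if unlift ord0 i is Some j then c j else a) => [i|].
    case: unlift => //; rewrite /a subr_ge0; apply: (@le_trans _ _ 0).
      apply: sumr_le0 => j _; rewrite mulr_ge0_le0// mulr_le0_ge0 ?invr_ge0 ?vd//.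
      exact: ltW.
    by rewrite divr_ge0 ?ltW.
  rewrite big_ord_recl unlift_none.
  under eq_bigr do rewrite liftK.
  rewrite -[LHS](subrK ((dot u d / dot v0 d) *: v0)) -/(p u) uE /a scalerBl scaler_suml.
  have -> : \sum_i c i *: p (vs i) = \sum_i c i *: vs i -
      \sum_i (c i * (dot (vs i) d / dot v0 d)) *: v0.
    by rewrite -sumrB; apply: eq_bigr => i _; rewrite /p scalerBr scalerA.
  by rewrite addrC addrA addrAC.
(* The adjoint of [p] turns [e] into a vector orthogonal to [v0]. *)
right; have dotE z : dot z (e - (dot v0 e / dot v0 d) *: d) = dot (p z) e.
  by rewrite /p dotBl dotZl dotBr dotZr; congr (_ - _); ring.
exists (e - (dot v0 e / dot v0 d) *: d).
  by rewrite dotE.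
move=> i; case: (unliftP ord0 i) => [j ->|->].
  by rewrite dotE; exact: ve.
by rewrite dotBr dotZr -/v0 divfK ?gt_eqF// subrr.
Qed.

End Farkas.

(** * Cardinality of images of index sets *)

Section Image.
Context {T : Type} {I : finType}.
Variable w : I -> T.
Hypothesis w_inj : injective w.

Lemma image_card (A : {set I}) : (w @` [set` A]) #= `I_#|A|.
Proof.
have -> : w @` [set` A] = (w \o enum_val) @` [set: 'I_#|A|].
  apply/seteqP; split=> [_ [i /= iA <-]|_ [k _ <-]].
    by exists (enum_rank_in iA i) => //=; rewrite enum_rankK_in.
  by exists (enum_val k) => //=; exact: enum_valP.
apply: card_eq_trans (inj_card_eq _) (card_esym card_II) => i j _ _ /w_inj.
exact: enum_val_inj.
Qed.

End Image.

(** * Conical position, simple arrangements and concurrent hyperplanes *)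

Section Conical.
Context {R : realType} {n : nat} {I : finType}.
Local Notation V := 'rV[R]_n.
Variable w : I -> V.
Hypothesis w1 : forall i, dot (w i) (w i) = 1.
Hypothesis w_inj : injective w.
Implicit Types (h g : I -> R) (x y : V) (A B : {set I}).

Lemma concurrent_conical h A x : valid w h -> A != finset.set0 -> A \subset tight w h x ->
  conical_position (w @` [set` A]).
Proof.
move=> [hf [z hz]] /finset.set0Pn[i0 i0A] /fintype.subsetP At.
have {}At i : i \in A -> dot (w i) x = h i by move=> /At; rewrite in_tight => /eqP.
split.
- by apply: finite_image; exact: finite_finset.
- have zx i : i \in A -> 0 < dot (x - z) (w i).
    by move=> iA; rewrite dotC dotBr subr_gt0 At.
  have [b b0 hb] : exists2 b : R, 0 < b & forall i, i \in A -> b < dot (x - z) (w i).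
    apply/small_ex/small_forall => i; have [iA|_] := boolP (i \in A); last by exists 1.
    by exists (dot (x - z) (w i)) => [|t /andP[]]; first exact: zx.
  exists (x - z), b; split; rewrite ?dot0r//; last by move=> _ [i iA <-]; exact: hb.
  by apply: contraTneq (zx _ i0A) => ->; rewrite dot0l ltxx.
move=> _ [i iA <-] [m [v [c [hv c0 iE]]]].
have [y yi yj] := hf i.
(* All other normals of [A] are negative on [y - x] while [w i] vanishes there, so the coefficients
   are all 0, contradicting that [w i] is a unit vector. *)
have vy k : dot (v k) (y - x) < 0.
  have [[j jA <-] ji] := hv k; rewrite dotBr subr_lt0 At// yj//.
  by apply/eqP => e; apply: ji; rewrite /= e.
have : \sum_k c k * - dot (v k) (y - x) == 0.
  have : dot (w i) (y - x) = 0 by rewrite dotBr yi At// subrr.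
  rewrite {1}iE dot_suml => /eqP; rewrite -oppr_eq0 -sumrN.
  by under eq_bigr do rewrite dotZl -mulrN.
rewrite psumr_eq0 => [/allP h0|k _]; last by rewrite mulr_ge0// oppr_ge0 ltW.
have /eqP := unit_neq0 (w1 i); apply; rewrite iE big1// => k _.
have := h0 k (mem_index_enum _); rewrite /= mulf_eq0 oppr_eq0 (lt_eqF (vy k)) orbF.
by move=> /eqP->; rewrite scale0r.
Qed.

Definition no_conical := ~ exists S : set V,
  [/\ S `<=` range w, S #= `I_n.+1 & conical_position S].

(** Otherwise the [n] hyperplanes of [B] and that of [i] would be concurrent. *)
Lemma gap_neq0 h B i : no_conical -> valid w h -> is_basis w B -> i \notin B ->
  gap w B h i != 0.
Proof.
move=> nc vh bB iB; apply: contra_notN nc => /eqP/eqP; rewrite subr_eq0 => /eqP e.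
exists (w @` [set` (i |: B)%SET]); split.
- by move=> _ [j _ <-]; exists j.
- by have := image_card w_inj (i |: B)%SET; rewrite cardsU1 iB (card_basis bB).
- apply: (@concurrent_conical h _ (vertex w B h)) => //.
    by apply/finset.set0Pn; exists i; rewrite finset.setU11.
  apply/fintype.subsetP => j; rewrite in_tight in_setU1 => /orP[/eqP->|jB].
    by rewrite -e.
  by rewrite vertexP.
Qed.

Lemma gap_sign h g B i : no_conical -> valid w h -> valid w g -> is_basis w B -> i \notin B ->
  Num.sg (gap w B h i) = Num.sg (gap w B g i).
Proof.
move=> nc; wlog lhg : h g / gap w B h i <= gap w B g i.
  move=> hw vh vg bB iB; have [l|/ltW l] := leP (gap w B h i) (gap w B g i); first exact: hw.
  by apply/esym/hw.
move=> vh vg bB iB.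
have h0 := gap_neq0 nc vh bB iB; have g0 := gap_neq0 nc vg bB iB.
move/lt_total: h0 => /orP[h0|h0]; last first.
  by rewrite !gtr0_sg// (lt_le_trans h0).
move/lt_total: g0 => /orP[g0|g0]; first by rewrite !ltr0_sg.
(* The zero of the gap on the segment of valid offsets from [h] to [g]. *)
pose t := gap w B h i / (gap w B h i - gap w B g i).
have t01 : 0 <= t <= 1.
  rewrite /t -mulrNN -invrN divr_ge0 ?ler_pdivrMr; lra.
have /eqP := gap_neq0 nc (valid_convex vh vg t01) bB iB; case.
rewrite (gap_affine _ _ _ (fun i => g i - h i)).
have -> : (fun i => g i - h i) = (fun i => g i + -1 * h i).
  by apply/funext => j; rewrite mulN1r.
by rewrite gap_affine /t; field; lra.
Qed.

(** Take a vertex below [x] and its counterpart for [g]. A small step along dual vectors gives the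
    hyperplanes of [B] any prescribed signs; the other signs are nonzero at the vertex, survive the
    step and agree by [gap_sign]. *)
Lemma covectors_sub h g x : no_conical -> spanning w [set: I]%SET ->
  valid w h -> valid w g -> exists y, sgn w g y = sgn w h x.
Proof.
move=> nc sp vh vg.
have [z zx sz] := vertex_below h x sp.
have [B /fintype.subsetP Bz bB] := basis_exists sz.
have zE : z = vertex w B h by apply: vertex_unique => // i /Bz; rewrite in_tight => /eqP.
have sgE (f : I -> R) i : sgn w f (vertex w B f) i = - Num.sg (gap w B f i).
  by rewrite /sgn -sgrN opprB.
pose d := \sum_(b in B) sgn w h x b *: dual w B b.
have dB i : i \in B -> dot (w i) d = sgn w h x i by exact: (vertexP (sgn w h x) bB).
have [t t0 ht] : exists2 t, 0 < t & forall i, i \notin B ->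
    Num.sg (dot (w i) (vertex w B g) - g i + t * dot (w i) d) = sgn w g (vertex w B g) i.
  apply/small_ex/small_forall => i; have [_|iB] := boolP (i \in B); first by exists 1.
  have [|e e0 he] := @small_sg _ (dot (w i) (vertex w B g) - g i) (dot (w i) d).
    by rewrite -opprB oppr_eq0; exact: gap_neq0.
  by exists e => // t /he ->.
exists (vertex w B g + t *: d); apply/funext => i.
rewrite {1}/sgn dotDr dotZr addrAC; have [iB|iB] := boolP (i \in B).
  by rewrite vertexP// subrr add0r dB// sgrM gtr0_sg// mul1r sgr_id.
rewrite ht// sgE -(gap_sign nc vh vg bB iB) -sgE -zE.
case: (zx i) => // /eqP; rewrite zE sgE oppr_eq0 sgr_eq0.
by rewrite (negPf (gap_neq0 nc vh bB iB)).
Qed.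

Lemma no_conical_equivalent h g : no_conical -> spanning w [set: I]%SET ->
  valid w h -> valid w g ->
  combinatorially_equivalent (hyperplanes w h) (hyperplanes w g).
Proof. by move=> *; apply: equivalent_hyperplanes => x; apply: covectors_sub. Qed.

(** The unit ball around [c] touches the hyperplane through 0 with normal [w k] and stays on the
    inner side of those of all [j] in [A]. *)
Lemma conical_center A k : conical_position (w @` [set` A]) -> k \in A ->
  exists2 c, dot (w k) c = -1 & forall j, j \in A -> dot (w j) c <= -1.
Proof.
move=> [_ [a [b [_ + hb]]] hpos] kA; rewrite dot0r => b0.
have {}hb j : j \in A -> 0 < dot (w j) a.
  by move=> jA; rewrite dotC; apply: (lt_trans b0); apply: hb; exists j.
have [d kd jd] : exists2 d, 0 < dot (w k) d & forall j, j \in A -> j != k -> dot (w j) d <= 0.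
  have [[c c0 kE]|[d kd jd]] := farkas (fun l : 'I_#|A :\ k| => w (enum_val l)) (w k).
    exfalso; apply: (hpos (w k)); first by exists k.
    exists #|A :\ k|, (fun l => w (enum_val l)), c; split=> // l.
    have := enum_valP l; rewrite in_setD1 => /andP[lk lA]; split; first by exists (enum_val l).
    by move=> /= /w_inj/eqP; rewrite (negPf lk).
  exists d => // j jA jk.
  have jAk : j \in A :\ k by rewrite in_setD1 jk.
  by have := jd (enum_rank_in jAk j); rewrite enum_rankK_in.
(* Subtracting a multiple of the separating vector [a] makes the product with [w k] vanish and the
   other products strictly negative. *)
pose e := d - (dot (w k) d / dot (w k) a) *: a.
have ke : dot (w k) e = 0.
  by rewrite dotBr dotZr divfK ?subrr// gt_eqF// hb.
have je j : j \in A -> j != k -> dot (w j) e < 0.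
  move=> jA jk; rewrite dotBr dotZr subr_lt0; apply: (le_lt_trans (jd j jA jk)).
  by rewrite mulr_gt0 ?hb// divr_gt0 ?hb.
have [t t0 ht] : exists2 t : R, 0 < t & forall j, j \in A -> j != k -> t < - dot (w j) e.
  apply/small_ex/small_forall => j.
  have [jA|_] := boolP (j \in A); last by exists 1.
  have [_|jk] := eqVneq j k; first by exists 1.
  by exists (- dot (w j) e) => [|t /andP[]//]; rewrite oppr_gt0 je.
(* The term in [a] gives [w k] the value -1; the large multiple of [e] pushes the other products
   below -1 without changing that of [w k]. *)
exists (t^-1 *: e - (dot (w k) a)^-1 *: a).
  by rewrite dotBr !dotZr ke mulr0 mulVf ?add0r// gt_eqF// hb.
move=> j jA; rewrite dotBr !dotZr; have [->|jk] := eqVneq j k.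
  by rewrite ke mulr0 mulVf ?add0r// gt_eqF// hb.
have h1 : 0 <= (dot (w k) a)^-1 * dot (w j) a by rewrite mulr_ge0 ?invr_ge0 ?ltW ?hb.
have h2 : t^-1 * dot (w j) e <= -1.
  by rewrite mulrC ler_pdivrMr// mulN1r lerNr; exact/ltW/ht.
lra.
Qed.

(* The offsets are those of the polytope circumscribed about the union of the
   unit balls around the centers. *)
Lemma conical_concurrent A : conical_position (w @` [set` A]) -> A != finset.set0 ->
  exists2 h, valid w h & forall i, i \in A -> h i = 0.
Proof.
move=> cA /finset.set0Pn[i0 i0A].
have : forall k : {k | k \in A}, exists c, dot (w (val k)) c = -1 /\
    forall j, j \in A -> dot (w j) c <= -1.
  by move=> [k kA]; have [c] := conical_center cA kA; exists c.
move=> /choice[c hc].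
have : forall i, exists k : {k | k \in A}, forall l, dot (w i) (c l) <= dot (w i) (c k).
  move=> i; have [k _ hk] := argmin_exists (P := xpredT) (i0 := Sub i0 i0A)
    (fun k : {k | k \in A} => - dot (w i) (c k)) isT.
  by exists k => l; rewrite -lerN2 hk.
move=> /choice[k hk]; exists (fun i => dot (w i) (c (k i)) + 1).
  exact: (valid_support w1 w_inj (Sub i0 i0A)).
move=> i iA; suff -> : dot (w i) (c (k i)) = -1 by rewrite addNr.
apply/le_anti; rewrite (hc (k i)).2//=.
by rewrite -(hc (Sub i iA)).1 hk.
Qed.

(** More than [n] hyperplanes pass through a vertex [y]. A basis [B1] among them omits some [s];
    dropping a suitable [b] of [B1] leaves a spanning set because [s] replaces it, hence a second
    basis at [y]. *)
Lemma concurrent_bases h A x : spanning w [set: I]%SET -> A \subset tight w h x ->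
  #|A| = n.+1 -> exists B1 B2, [/\ is_basis w B1, is_basis w B2, B1 != B2 &
    vertex w B1 h = vertex w B2 h].
Proof.
move=> sp Ax cA; have [y /below_tight xy sy] := vertex_below h x sp.
have Bv B : B \subset tight w h y -> is_basis w B -> y = vertex w B h.
  move=> /fintype.subsetP By bB; apply: vertex_unique => // i /By.
  by rewrite in_tight => /eqP.
have [B1 B1y b1] := basis_exists sy.
have [s sy' sB] : exists2 s, s \in tight w h y & s \notin B1.
  apply/fintype.subsetPn; apply: contraTN (subset_leq_card (fintype.subset_trans Ax xy)).
  by move=> /subset_leq_card; rewrite cA (card_basis b1) -ltnNge ltnS.
have [b bB sb] : exists2 b, b \in B1 & dot (w s) (dual w B1 b) != 0.
  apply: contrapT => /forall2NP no; have := w1 s.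
  rewrite {2}(basis_expand (w s) b1) dot_sumr big1 => [/esym/eqP|b bB].
    by rewrite oner_eq0.
  rewrite dotZr; case: (no b) => // /negP; rewrite negbK => /eqP->.
  by rewrite mulr0.
have [v hv|B2 B2y b2] := @basis_exists _ _ _ w (tight w h y :\ b)%SET.
  have hB c : c \in B1 -> c != b -> dot (w c) v = 0.
    by move=> cB cb; apply: hv; rewrite in_setD1 cb (fintype.subsetP B1y).
  have vE : v = dot (w b) v *: dual w B1 b.
    rewrite {1}(basis_expand v b1) (bigD1 b)//= big1 ?addr0// => c /andP[cB cb].
    by rewrite hB// scale0r.
  have : dot (w s) v = 0.
    by apply: hv; rewrite in_setD1 sy' andbT; apply: contraNneq sB => ->.
  rewrite vE dotZr => /eqP; rewrite mulf_eq0 (negPf sb) orbF => /eqP e.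
  by rewrite e scale0r.
exists B1, B2; split=> //.
  apply: contraTneq bB => ->; apply/negP => /(fintype.subsetP B2y).
  by rewrite in_setD1 eqxx.
by rewrite -!Bv// (fintype.subset_trans B2y)// finset.subsetDl.
Qed.

(* A non-zero gap survives small changes of the offsets, and moving [h i] alone
   changes [gap w B h i], so the number of vanishing gaps can be decreased to 0. *)
Lemma generic_valid : exists2 h, valid w h &
  forall B i, is_basis w B -> i \notin B -> gap w B h i != 0.
Proof.
pose bad h := [set p : {set I} * I |
  [&& is_basis w p.1, p.2 \notin p.1 & gap w p.1 h p.2 == 0]]%SET.
have [h0 v0] : exists h, valid w h.
  (* All offsets are 1: the polytope circumscribed about the unit ball. *)
  exists (fun i => dot (w i) 0 + 1).
  by apply: (valid_support w1 w_inj (c := fun _ : unit => 0) (k := fun=> tt) tt) => i _.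
have [k] := ubnP #|bad h0|; elim: k h0 v0 => // k IH h vh; rewrite ltnS => hk.
have [e|/finset.set0Pn[[B i] Bi]] := eqVneq (bad h) finset.set0.
  exists h => // B i bB iB; apply/negP => g0.
  by have := finset.in_set0 (B, i); rewrite -e finset.in_set /= bB iB g0.
pose g j : R := (j == i)%:R.
move: (Bi); rewrite finset.in_set /= => /and3P[bB iB /eqP gi].
have gg : gap w B g i = 1.
  rewrite /gap /g eqxx /vertex big1 ?dot0r ?subr0// => b bB'.
  by rewrite (_ : b == i = false) ?scale0r//; apply: contraNF iB => /eqP<-.
have [t t0 [vt ht]] : exists2 t, 0 < t & valid w (fun j => h j + t * g j) /\
    forall p : {set I} * I, gap w p.1 h p.2 != 0 -> gap w p.1 h p.2 + t * gap w p.1 g p.2 != 0.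
  apply: small_ex; apply: small_and; first exact: valid_perturb.
  apply: small_forall => p; have [->|p0] := eqVneq (gap w p.1 h p.2) 0; first by exists 1.
  by have [e e0 he] := small_neq0 (gap w p.1 g p.2) p0; exists e => // t /he.
apply: (IH _ vt); apply: leq_trans hk; apply: proper_card.
apply/fintype.properP; split.
  apply/fintype.subsetP => p; rewrite !finset.in_set gap_affine => /and3P[-> ->] /=.
  by apply: contraTT => /ht.
exists (B, i) => //; rewrite finset.in_set /= gap_affine gi gg add0r mulr1.
by rewrite gt_eqF// !andbF.
Qed.

Lemma equivalent_minimal (A A' : set (set V)) f C : set_bij (cells A) (cells A') f ->
  (forall C D, cells A C -> cells A D -> (f C `<=` f D <-> C `<=` D)) ->
  cells A C -> minimal_cell A C <-> minimal_cell A' (f C).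
Proof.
move=> [fA finj fsurj] fmono AC; split=> [[_ hm]|[_ hm]]; split=> //.
- exact: fA.
- move=> D' /fsurj[D AD <-] DC; congr f; apply: hm => //; exact/fmono.
- move=> D AD DC; apply: finj; rewrite ?inE//; apply: hm; first exact: fA.
  exact/fmono.
Qed.

(** By genericity, distinct bases give distinct vertices for [h1]. Matching these with the vertices
    for [h2] gives an injection [phi] of the finite set of bases into itself; being onto, it carries
    the distinctness over to [h2]. *)
Lemma equivalent_vertex_injection h1 h2 (A : set (set V)) :
  spanning w [set: I]%SET ->
  combinatorially_equivalent (hyperplanes w h1) A ->
  combinatorially_equivalent (hyperplanes w h2) A ->
  (forall B i, is_basis w B -> i \notin B -> gap w B h1 i != 0) ->
  forall B B', is_basis w B -> is_basis w B' -> vertex w B h2 = vertex w B' h2 -> B = B'.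
Proof.
move=> sp [f1 [bij1 mono1]] [f2 [bij2 mono2]] gen.
have minv h B : is_basis w B -> minimal_cell (hyperplanes w h) [set vertex w B h].
  by move=> bB; apply/minimal_cellE => //; exists B.
have : forall B, exists B', is_basis w B ->
    is_basis w B' /\ f2 [set vertex w B' h2] = f1 [set vertex w B h1].
  move=> B; have [bB|_] := boolP (is_basis w B); last by exists B.
  have mB := minv h1 _ bB; have cB := mB.1.
  have m1 : minimal_cell A (f1 [set vertex w B h1]).
    exact/(equivalent_minimal bij1 mono1 cB).
  have [_ _ /(_ _ m1.1)[D cD DE]] := bij2.
  have : minimal_cell (hyperplanes w h2) D.
    by apply/(equivalent_minimal bij2 mono2 cD); rewrite DE.
  by move=> /(minimal_cellE _ _ sp)[B' bB' D'E]; exists B' => _; rewrite -D'E.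
move=> /choice[phi hphi].
have f1_inj B B' : is_basis w B -> is_basis w B' ->
    f1 [set vertex w B h1] = f1 [set vertex w B' h1] -> B = B'.
  move=> bB bB'; have [_ inj1 _] := bij1.
  move=> /inj1; rewrite !inE => /(_ (minv h1 _ bB).1 (minv h1 _ bB').1).
  move=> /seteqP[/(_ _ erefl) /= ve _].
  have sub C C' : is_basis w C -> is_basis w C' -> vertex w C h1 = vertex w C' h1 -> C \subset C'.
    move=> bC bC' vC; apply/fintype.subsetP => i iC; apply: contraT => iC'.
    have := gen C' i bC' iC'; rewrite /gap -vC vertexP//.
    by rewrite subrr eqxx.
  by apply/eqP; rewrite finset.eqEsubset !sub.
have phi_inj : {in is_basis w &, injective phi}.
  move=> B B' bB bB' e; have [_ eB] := hphi B bB; have [_ eB'] := hphi B' bB'.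
  by apply: f1_inj => //; rewrite -eB -eB' e.
have phi_surj B : is_basis w B -> exists2 C, is_basis w C & phi C = B.
  move=> bB; pose T := [set C | is_basis w C]%SET.
  have TT : phi @: T = T.
    apply/eqP; rewrite finset.eqEcard; apply/andP; split.
      apply/fintype.subsetP => _ /finset.imsetP[C + ->]; rewrite !finset.in_set => bC.
      by have [] := hphi C bC.
    rewrite card_in_imset// => C C'; rewrite !finset.in_set; exact: phi_inj.
  have : B \in phi @: T by rewrite TT finset.in_set.
  by move=> /finset.imsetP[C]; rewrite finset.in_set => bC ->; exists C.
move=> B B' /phi_surj[C bC <-] /phi_surj[C' bC' <-] e; congr phi.
have [_ eC] := hphi C bC; have [_ eC'] := hphi C' bC'; apply: f1_inj => //.
by rewrite -eC -eC' e.
Qed.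

End Conical.

Theorem theorem6 (R : realType) (n : nat) (P : set 'rV[R]_n)
    (polyP : polytope P) (dimP : has_dim P n) :
  strongly_monotypic P <->
  ~ exists S : set 'rV[R]_n,
      [/\ S `<=` normals P, S #= `I_n.+1 & conical_position S].
Proof.
have [I [w [w_inj NP]]] := finite_range (polytope_finite_normals polyP dimP).
have w1 i : dot (w i) (w i) = 1.
  by have /normalsP[F [c []]] : normals P (w i) by rewrite NP; exists i.
have ps : positively_spanning w.
  move=> v v0; have [u + uv] := polytope_normals_pos polyP dimP v0.
  by rewrite NP => -[i _ iu]; exists i; rewrite iu.
have sp := positively_spanning_spanning ps.
have convexQ (Q : set 'rV[R]_n) : polytope Q -> convex Q.
  by move=> [A [_ ->]]; exact: conv_hull_convex.
rewrite NP; split=> [sm [S [Sw Sc cS]]|nc Q polyQ dimQ NQ]; last first.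
  rewrite NP in NQ.
  have [h -> [vh _]] := facet_offsets w1 w_inj (convexQ _ polyQ) dimQ NQ.
  have [g -> [vg _]] := facet_offsets w1 w_inj (convexQ _ polyP) dimP NP.
  exact: no_conical_equivalent.
pose A := [set i | `[< S (w i) >]]%SET.
have SA : S = w @` [set` A].
  apply/seteqP; split=> [x Sx|_ [i /= + <-]]; last by rewrite finset.in_set => /asboolP.
  by have [i _ ix] := Sw x Sx; exists i => //=; rewrite finset.in_set ix; apply/asboolP.
have cA : #|A| = n.+1.
  by apply/card_eq_II; apply: card_eq_trans Sc; rewrite SA card_eq_sym image_card.
have A0 : A != finset.set0 by rewrite -card_gt0 cA.
(* Any valid offsets are realized by a polytope with the normals of [P], to which strong monotypy
   applies. *)
have smw h : valid w h -> combinatorially_equivalent (hyperplanes w h) (facet_arrangement P).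
  move=> vh; rewrite -(polyhedron_arrangement w1 w_inj vh); apply: sm.
  - exact: polyhedron_polytope.
  - exact: polyhedron_full.
  - by rewrite NP polyhedron_normals.
rewrite SA in cS.
(* [h0] makes two bases share a vertex, whereas [h1] is generic; both arrangements are equivalent to
   that of [P]. *)
have [h0 v0 h00] := conical_concurrent w1 w_inj cS A0.
have [h1 v1 gen] := generic_valid w1 w_inj.
have [|B1 [B2 [b1 b2 B12 e]]] := concurrent_bases (x := 0) w1 sp _ cA (h := h0).
  by apply/fintype.subsetP => i iA; rewrite in_tight dot0r h00.
by move/eqP: B12; apply; apply: (equivalent_vertex_injection sp (smw _ v1) (smw _ v0) gen).
Qed.
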